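(* Let $\lambda$ be a shape. Any linear extension of the Grid-Tamari order $\mathrm{GT}(\lambda)$ is a shelling order on the facets of the reduced nonkissing complex $\widetilde\Delta^{NK}(\lambda)$. Moreover, the $h$-polynomial of $\widetilde\Delta^{NK}(\lambda)$ equals the $f$-polynomial of the nonfriendly complex $\Gamma^{NF}(\lambda)$.
   Context: A shape is a finite vertex-induced subgraph $\lambda$ of the square grid $\mathbb{Z}^2$ (two points are adjacent iff they differ by 1 in exactly one coordinate and agree in the other). $(a,b)$ is immediately South of $(a,b+1)$ and immediately East of $(a-1,b)$; North and West are the reverse relations. A vertex of $\lambda$ is interior if all four of its grid neighbors are in $\lambda$, and a boundary vertex otherwise. A (boundary) path is a sequence of vertices $(v_0,\ldots,v_l)$ of $\lambda$, $l>0$, with $v_0,v_l$ boundary vertices, $v_1,\dots,v_{l-1}$ interior vertices, and each $v_i$ immediately South or East of $v_{i-1}$. A segment is a sequence of interior vertices $(v_0,\ldots,v_l)$, $l\ge 0$, with each $v_i$ immediately South or East of $v_{i-1}$. If $t=(v_i,\dots,v_j)$ is a contiguous subsequence of a path or segment $p=(v_0,\dots,v_l)$, then $p$ starts with $t$ if $i=0$ and otherwise enters $t$ from the West (resp. North) if $v_{i-1}$ is immediately West (resp. North) of $v_i$; $p$ ends with $t$ if $j=l$ and otherwise leaves $t$ to the East (resp. South) if $v_{j+1}$ is immediately East (resp. South) of $v_j$. Two segments $s,t$ are friendly along a common subsegment $u$ if, up to exchanging $s$ and $t$: $s$ starts with $u$ or enters $u$ from the West, and $s$ ends with $u$ or leaves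 $u$ to the South; and $t$ starts with $u$ or enters $u$ from the North, and $t$ ends with $u$ or leaves $u$ to the East. $\Gamma^{NF}(\lambda)$ is the simplicial complex of sets of segments (including $\emptyset$) whose distinct members are pairwise not friendly along any segment. Two paths $p,q$ kiss along a common segment $s$ if (up to exchanging) $p$ enters $s$ from the West and leaves to the South, while $q$ enters $s$ from the North and leaves to the East. The reduced nonkissing complex $\widetilde\Delta^{NK}(\lambda)$ has as faces the sets (including $\emptyset$) of pairwise nonkissing paths that are neither horizontal (only East steps) nor vertical (only South steps). It is known to be pure and thin, and if $F,F'$ are facets with $F\setminus\{p\}=F'\setminus\{q\}$, $p\ne q$, then $p,q$ kiss along a unique segment $s$. Write $F\xrightarrow{s}F'$ (a flip) if here $p$ enters $s$ from the West and leaves to the South and $q$ enters $s$ from the North and leaves to the East. The Grid-Tamari order $\mathrm{GT}(\lambda)$ is the poset on facets of $\widetilde\Delta^{NK}(\lambda)$ with $F\le F'$ iff $F'$ is obtained from $F$ by a (possibly empty) sequence of flips. A total order $F_1,F_2,\dots$ on the facets of a pure simplicial complex is a shelling order if for all $i<j$ there is $k<j$ such that $F_k\cap F_j$ is a ridge (codimension-1 face) containing $F_i\cap F_j$. For a simplicial complex with $f_d$ faces of dimension $d$ ($f_{-1}=1$), the $f$-polynomial is $f(t)=\sum_d f_{d-1}t^d$; if its maximal dimension is $r-1$, the $h$-polynomial $h(t)$ is defined by $h(t+1)=t^rf(1/t)$, i.e. $h(t)=\sum_{d=0}^r f_{d-1}(t-1)^{r-d}$. *)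

(* Defs.v *)
From HB Require Import structures.
From mathcomp Require Import all_boot all_order all_algebra.
From mathcomp Require Import finmap.

Set Implicit Arguments.
Unset Strict Implicit.
Unset Printing Implicit Defensive.

Import Order.TTheory GRing.Theory Num.Theory.
Local Open Scope ring_scope.

(** * Finite simplicial complexes

   A complex on the finite type [T] is given by its set of faces; a face of
   dimension [d - 1] is a face with [d] elements. *)

Section Complexes.
Variable T : finType.
Implicit Types (K : {set {set T}}) (V F : {set T}) (s : seq {set T}).

Definition avoiding_complex V (r : rel T) : {set {set T}} :=
  [set A : {set T} | (A \subset V) &&
     [forall x in A, forall y in A, (x != y) ==> ~~ r x y]].

Definition facets K : {set {set T}} := [set F | maxset (mem K) F].

(* The maximal number of elements of a face, i.e. the dimension plus one. *)
Definition crank K : nat := \max_(A in K) #|A|.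

Definition pure K : bool := [forall F in facets K, #|F| == crank K].

Definition ridge K A : bool := (A \in K) && (#|A|.+1 == crank K).

Definition enumerates s (X : {set {set T}}) : Prop := uniq s /\ s =i X.

(* A total order on the facets is given by the list of facets in that order. *)
Definition shelling_order K s : Prop :=
  [/\ pure K, enumerates s (facets K) &
      forall i j, (i < j < size s)%N ->
      exists k, [/\ (k < j)%N,
        ridge K (nth set0 s k :&: nth set0 s j) &
        nth set0 s i :&: nth set0 s j \subset nth set0 s k :&: nth set0 s j]].

Definition linear_extension (X : {set {set T}}) (le : rel {set T}) s : Prop :=
  enumerates s X /\
  {in X &, forall F F', le F F' -> (index F s <= index F' s)%N}.

Definition fnum K (d : nat) : nat := #|[set A in K | #|A| == d]|.

Definition f_poly K : {poly int} :=
  \sum_(d < (crank K).+1) (fnum K d)%:Z *: 'X^d.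

Definition h_poly K : {poly int} :=
  \sum_(d < (crank K).+1) (fnum K d)%:Z *: ('X - 1) ^+ (crank K - d).

End Complexes.

(** * Shapes, paths and segments *)

Definition point : Type := (int * int)%type.

Definition north (v : point) : point := (v.1, v.2 + 1).
Definition south (v : point) : point := (v.1, v.2 - 1).
Definition east (v : point) : point := (v.1 + 1, v.2).
Definition west (v : point) : point := (v.1 - 1, v.2).

Definition se_step : rel point := fun u v => (v == south u) || (v == east u).

(* An induced subgraph of the grid is determined by its vertex set. *)
Definition grid_shape : Type := {fset (int * int)}.

Definition interior (lambda : grid_shape) (v : point) : bool :=
  [&& v \in lambda, north v \in lambda, south v \in lambda,
      east v \in lambda & west v \in lambda].

Definition boundary (lambda : grid_shape) (v : point) : bool :=
  (v \in lambda) && ~~ interior lambda v.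

Definition is_path (lambda : grid_shape) (w : seq point) : bool :=
  if w is v0 :: v1 :: w' then
    [&& boundary lambda v0, boundary lambda (last v1 w'),
        all (interior lambda) (belast v1 w') & path se_step v0 (v1 :: w')]
  else false.

Definition is_segment (lambda : grid_shape) (w : seq point) : bool :=
  [&& w != [::], all (interior lambda) w & sorted se_step w].

Definition horizontal (w : seq point) : bool :=
  sorted (fun u v => v == east u) w.
Definition vertical (w : seq point) : bool :=
  sorted (fun u v => v == south u) w.

(* [enters_from west t p] says that [t] occurs in [p], preceded by the point
   immediately West of its first point; similarly for [leaves_to].  The points
   of a path or segment are pairwise distinct, so [t] occurs at most once in it
   and conjunctions of these predicates with one another, or with [prefix] and
   [suffix], refer to the same occurrence. *)
Definition enters_from (dir : point -> point) (t p : seq point) : bool :=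
  if t is v :: _ then infix (dir v :: t) p else false.

Definition leaves_to (dir : point -> point) (t p : seq point) : bool :=
  if t is v :: t' then infix (rcons t (dir (last v t'))) p else false.

Definition friendly_along (u s t : seq point) : bool :=
  [&& prefix u s || enters_from west u s, suffix u s || leaves_to south u s,
      prefix u t || enters_from north u t & suffix u t || leaves_to east u t].

Definition kiss_along (s p q : seq point) : bool :=
  [&& enters_from west s p, leaves_to south s p,
      enters_from north s q & leaves_to east s q].

(** * The two complexes and the Grid-Tamari order *)

(* A finite type containing all paths and segments of [lambda]: since their
   points are pairwise distinct, their length is at most the number of vertices
   of [lambda] (see [path_word] and [segment_word]). *)
Definition word (lambda : grid_shape) : finType := {bseq #|` lambda|%fset of lambda}.

Definition pts (lambda : grid_shape) (w : word lambda) : seq point :=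
  [seq val v | v : lambda <- w].

Section GridTamari.
Variable lambda : grid_shape.
Implicit Types (p q s t u : word lambda) (F : {set word lambda}).

Definition friendly s t : bool :=
  [exists u : word lambda, is_segment lambda (pts u) &&
     (friendly_along (pts u) (pts s) (pts t) ||
      friendly_along (pts u) (pts t) (pts s))].

Definition kissing p q : bool :=
  [exists s : word lambda, is_segment lambda (pts s) &&
     (kiss_along (pts s) (pts p) (pts q) ||
      kiss_along (pts s) (pts q) (pts p))].

Definition nonfriendly_complex : {set {set word lambda}} :=
  avoiding_complex [set s | is_segment lambda (pts s)] friendly.

Definition reduced_nonkissing_complex : {set {set word lambda}} :=
  avoiding_complex
    [set p | [&& is_path lambda (pts p), ~~ horizontal (pts p)
               & ~~ vertical (pts p)]]
    kissing.

Definition flip_along s F F' : bool :=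
  [&& is_segment lambda (pts s),
      F \in facets reduced_nonkissing_complex,
      F' \in facets reduced_nonkissing_complex &
      [exists p in F, exists q in F',
        [&& p != q, F :\ p == F' :\ q & kiss_along (pts s) (pts p) (pts q)]]].

Definition flip F F' : bool := [exists s : word lambda, flip_along s F F'].

(* The order relation on the facets of [reduced_nonkissing_complex]. *)
Definition grid_tamari_le : rel {set word lambda} := connect flip.

End GridTamari.

Lemma se_path_uniq (v : point) (w : seq point) : path se_step v w -> uniq (v :: w).
Proof.
pose d (u : point) : int := u.1 - u.2.
have dlt u u' : se_step u u' -> d u < d u'.
  case: u => a b; rewrite /se_step /d => /orP[] /eqP -> /=.
    by rewrite opprB addrCA ltrDr //; rewrite -subr_gt0.
  by rewrite addrAC ltrDl.
move=> pw; have: sorted <%R (map d (v :: w)).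
  by rewrite sorted_map; exact: (sub_path (e' := relpre d <%R) dlt pw).
by move/lt_sorted_uniq; apply: map_uniq.
Qed.

Lemma uniq_word (lambda : grid_shape) (w : seq point) :
  uniq w -> {subset w <= lambda} -> exists w' : word lambda, pts w' = w.
Proof.
move=> uw sw.
pose z := pmap (insub : point -> option lambda) w.
have zE : map val z = w.
  rewrite /z pmap_filter; last by exact: insubK.
  by apply/all_filterP/allP => x /sw xl; rewrite isSome_insub.
have uz : uniq z by rewrite -(map_inj_uniq val_inj) zE.
have sz : (size z <= #|` lambda|%fset)%N.
  by rewrite cardfE -(card_uniqP uz) max_card.
by exists (Bseq sz).
Qed.

Lemma segment_word (lambda : grid_shape) (w : seq point) :
  is_segment lambda w -> exists w' : word lambda, pts w' = w.
Proof.
case: w => // v w /and3P[_ /allP iw sw]; apply: uniq_word.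
  exact: se_path_uniq sw.
by move=> x /iw /andP[].
Qed.

Lemma path_word (lambda : grid_shape) (w : seq point) :
  is_path lambda w -> exists w' : word lambda, pts w' = w.
Proof.
case: w => // v0 [//|v1 w] /and4P[/andP[b0 _] /andP[bl _] /allP iw sw].
apply: uniq_word; first exact: se_path_uniq sw.
move=> x; rewrite inE => /orP[/eqP-> //|].
rewrite lastI mem_rcons inE => /orP[/eqP-> //|].
by move=> /iw /andP[].
Qed.

(* Main.v *)
Require Import Defs.
From mathcomp Require Import all_boot all_order all_algebra.
From mathcomp Require Import finmap zify.

(* A word [u] contained in [w] is a quotient of [w] if [w] starts
   with [u] or enters it from the West, and ends with [u] or leaves it to the
   South; it is a subword if the same holds with North and East.  Segments are
   the string modules of a gentle algebra, "friendly" is the existence of a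
   nonzero morphism, and the nonfriendly sets are its semibricks.  A torsion
   pair [X] consists of a set [X true] of segments closed under quotients and a
   set [X false] closed under subwords, orthogonal to each other and maximal.
   The facets of the nonkissing complex are the sets of bent paths all of whose
   strict quotients (entered from the West and left to the South) lie in
   [X true] and whose strict subwords lie in [X false].  In such a facet every
   edge of the grid is distinguished for exactly one path, and every bent path
   has exactly one distinguished horizontal and one distinguished vertical edge.
   This gives purity, and the piece of the path between the two edges is a label
   of [X], a brick of the semibrick generating [X true] or its dual according to
   which edge comes first.  Flipping a path replaces [X true] by the part
   orthogonal to its label, so the Grid-Tamari order is the inclusion of the
   sets [X false].  Each face lies in exactly one interval from the paths with a
   label in [X false] to the whole facet, and the paths with a label in [X true]
   are counted by the semibrick. *)

Set Implicit Arguments.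
Unset Strict Implicit.
Unset Printing Implicit Defensive.

Import GRing.Theory.

(** * Junctions of a word *)

(* [lia] case-splits on every Boolean atom of the context. *)
Ltac arith :=
  first
  [ solve
    [ repeat match goal with
      | H : @eq bool _ _ |- _ => clear H
      | H : is_true ?b |- _ =>
          lazymatch b with
          | leq _ _ => fail
          | andb (leq _ _) (leq _ _) => fail
          | ~~ leq _ _ => fail
          | _ => clear H
          end
      end; lia ]
  | lia ].

(* A word with [n] points has junctions [0 < k < n], between its points [k - 1]
   and [k]; [d k] tells whether that step goes East, and [x c i j] whether the
   points [i, ..., j - 1] form an element of [X c] for a torsion pair [X].  The
   Boolean [c] is [true] for quotients and [false] for subwords, so that
   [subslice c] encodes both, and negating it is the symmetry of the theory. *)
Section Junctions.
Variables (n : nat) (d : nat -> bool) (x : bool -> nat -> nat -> bool).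

Definition cut c i i' := (i' == i) || (d i' == c).

Definition subslice c i j i' j' :=
  [&& i <= i', i' < j', j' <= j, cut c i i' & cut (~~ c) j j'].

Hypothesis x_closed : forall c i j i' j',
  0 < i -> j < n -> x c i j -> subslice c i j i' j' -> x c i' j'.
Hypothesis x_disjoint : forall c i j, x c i j -> x (~~ c) i j -> False.
Hypothesis x_witness : forall c i j, 0 < i -> i < j -> j < n -> ~~ x c i j ->
  exists i' j', subslice c i j i' j' /\ x (~~ c) i' j'.

(** Only junctions with the same direction as [k] are tested. These conditions are one half of
    [obeys]; in a compatible word the other half is automatic. *)
Definition distinguished k := [/\ 0 < k < n,
  forall j, k < j -> j < n -> d j = d k -> ~~ x (d k) k j &
  forall i, 0 < i -> i < k -> d i = d k -> ~~ x (~~ d k) i k].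

Definition compatible := forall c i j,
  0 < i -> i < j -> j < n -> d i = c -> d j = ~~ c -> x c i j.

(** Every other direction is dictated by [x] on the slice reaching to [k], so such a word can be
    built outward from its edge at [k], and in only one way. *)
Definition obeys k :=
  (forall j, k < j -> j < n -> (d j == ~~ d k) = x (d k) k j) /\
  (forall i, 0 < i -> i < k -> (d i == ~~ d k) = x (~~ d k) i k).

Lemma cutxx c i : cut c i i. Proof. by rewrite /cut eqxx. Qed.

Lemma cut_eq c i i' : d i' = c -> cut c i i'.
Proof. by rewrite /cut => ->; rewrite eqxx orbT. Qed.

Lemma cut_neq c i i' : cut c i i' -> i' != i -> d i' = c.
Proof. by move=> /orP[->//|/eqP]. Qed.

Lemma cut_dir c i i' : d i = c -> cut c i i' -> d i' = c.
Proof. by move=> di /orP[/eqP->|/eqP]. Qed.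

Lemma negb_neq (b c : bool) : b != c -> b = ~~ c.
Proof. by case: b c => [] []. Qed.

Lemma x_clash c i j i' j' : 0 < i -> j < n -> x c i j -> x (~~ c) i' j' ->
  subslice c i j i' j' -> False.
Proof. by move=> i0 jn xij y s; apply: x_disjoint y; apply: x_closed s. Qed.

Local Ltac sub := apply/and5P; split;
  first [by [] | by apply: cutxx | by apply: cut_eq; rewrite ?negbK | arith].

(** Torsion classes are closed under extensions. A witness against [[i, j)] on one side of [k]
    clashes with that half; one that straddles [k] is cut at [k], and [d k] decides which of its two
    pieces clashes. *)
Lemma x_extension c i k j : 0 < i -> i < k -> k < j -> j < n ->
  x c i k -> x c k j -> x c i j.
Proof.
move=> i0 ik kj jn xik xkj; apply/negPn/negP => nx.
have [i' [j' [/and5P[ii' ij' jj' si sj] y]]] := x_witness i0 (ltn_trans ik kj) jn nx.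
case: (leqP j' k) => [j'k|kj'].
  have {}sj : cut (~~ c) k j' by apply/cut_eq/(cut_neq sj); arith.
  by apply: (x_clash _ _ xik y); [arith..|sub].
case: (leqP k i') => [ki'|i'k].
  have {}si : cut c k i' by apply/cut_eq/(cut_neq si); arith.
  by apply: (x_clash _ _ xkj y); [arith..|sub].
have [dk|/negb_neq dk] := eqVneq (d k) c.
  have z : x (~~ c) i' k by apply: (x_closed _ _ y); [arith..|sub].
  by apply: (x_clash _ _ xik z); [arith..|sub].
have z : x (~~ c) k j' by apply: (x_closed _ _ y); [arith..|sub].
by apply: (x_clash _ _ xkj z); [arith..|sub].
Qed.

Lemma x_witness_strict c i j : 0 < i -> i < j -> j < n ->
  d i = c -> d j = ~~ c -> ~~ x c i j ->
  exists i' j', [/\ subslice c i j i' j', d i' = c, d j' = ~~ c & x (~~ c) i' j'].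
Proof.
move=> i0 ij jn di dj nx; have [i' [j' [s y]]] := x_witness i0 ij jn nx.
have /and5P[_ _ _ si sj] := s.
by exists i', j'; split=> //; [apply: cut_dir si|apply: cut_dir sj].
Qed.

(** A strict slice outside [x c] has a witness that is itself strict. Depending on where [k] lies
    relative to the witness, either closure or extension yields a slice with one end at [k] that
    violates [obeys], or the witness clashes with a slice that [obeys] provides. *)
Lemma obeys_compatible k : 0 < k -> k < n -> obeys k -> compatible.
Proof.
move=> k0 kn [fw bw] c i j i0 ij jn di dj; apply/negPn/negP => nx.
have [i' [j' [/and5P[ii' ij' jj' _ _] {}di {}dj]]] := x_witness_strict i0 ij jn di dj nx.
have {nx i0 ij jn ii' jj'} [i0 ij jn] : [/\ 0 < i', i' < j' & j' < n] by split; arith.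
move: i' j' {ij'} i0 ij jn di dj => {}i {}j i0 ij jn di dj y.
have [ec|/negb_neq ec] := eqVneq c (d k).
  rewrite {c}ec in di dj y.
  have [ki|ik] := ltnP k i.
    have xkj : x (d k) k j by rewrite -fw ?dj //; arith.
    by apply: (x_clash _ _ xkj y); [arith..|sub].
  move: ik; rewrite leq_eqVlt => /orP[/eqP ik|ik].
    by subst i; apply: (x_disjoint (c := d k)) y; rewrite -fw ?dj //; arith.
  have [kj|jk] := ltnP k j.
    have: x (~~ d k) i k by apply: (x_closed _ _ y) => //; sub.
    by rewrite -bw ?di //; arith.
  have {}jk : j < k by case: ltngtP jk dj => // ->; arith.
  have xjk : x (~~ d k) j k by rewrite -bw ?dj //; arith.
  have: x (~~ d k) i k by apply: x_extension y xjk.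
  by rewrite -bw ?di //; arith.
rewrite {c}ec !negbK in di dj y.
have [ki|ik] := ltnP k i.
  have xki : x (d k) k i by rewrite -fw ?di //; arith.
  have: x (d k) k j by apply: x_extension xki y.
  by rewrite -fw ?dj //; arith.
have {}ik : i < k by case: ltngtP ik di => // ->; arith.
have [kj|jk] := ltnP k j.
  have: x (d k) k j by apply: (x_closed _ _ y) => //; sub.
  by rewrite -fw ?dj //; arith.
have xik : x (~~ d k) i k by rewrite -bw ?di //; arith.
by apply: (x_clash _ _ xik (_ : x (~~ ~~ d k) i j)); rewrite ?negbK //; sub.
Qed.

Lemma distinguished_obeys k : compatible -> distinguished k -> obeys k.
Proof.
move=> cp [/andP[k0 kn] fw bw]; split=> [j kj jn|i i0 ik].
  have [dj|dj] := eqVneq (d j) (~~ d k); first by symmetry; apply: cp.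
  by apply/esym/negbTE/fw => //; rewrite (negb_neq dj) negbK.
have [di|di] := eqVneq (d i) (~~ d k); first by symmetry; apply: cp; rewrite ?negbK.
by apply/esym/negbTE/bw => //; rewrite (negb_neq di) negbK.
Qed.

Lemma obeys_distinguished k : 0 < k < n -> obeys k -> distinguished k.
Proof.
move=> kn [fw bw]; split=> // [j kj jn|i i0 ik] e.
  by rewrite -fw // e; case: (d k).
by rewrite -bw // e; case: (d k).
Qed.

(** If [k < k'], the slice [[k, k')] is outside [x (d k)]. Its witness either ends before [k'], so
    that it is strict and violates compatibility, or ends at [k'] and violates distinguishedness of
    [k']. *)
Lemma distinguished_inj k k' : compatible ->
  distinguished k -> distinguished k' -> d k = d k' -> k = k'.
Proof.
move=> cp; wlog kk' : k k' / k <= k' => [W|].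
  have [/W//|/ltnW/W W' dk dk' e] := leqP k k'.
  by apply/esym/W'.
move=> [/andP[k0 kn] fw bw] [/andP[k0' kn'] fw' bw'] e; apply/eqP; rewrite eqn_leq kk' /=.
rewrite leqNgt; apply/negP => {}kk'.
have nx : ~~ x (d k) k k' by apply: fw.
have [i [j [/and5P[ki ij jk' si sj] y]]] := x_witness k0 kk' kn' nx.
have di : d i = d k by apply: cut_dir si.
have [ejk'|ne] := eqVneq j k'; last first.
  by apply: x_disjoint y; apply: cp => //; [arith..|apply: cut_neq sj ne].
subst j; have [ik|ik] := eqVneq i k.
  have: ~~ x (~~ d k') k k' by apply: bw'.
  by rewrite -e; rewrite ik in y; rewrite y.
have: ~~ x (~~ d k') i k' by apply: bw'; rewrite ?di //; arith.
by rewrite -e y.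
Qed.

(** Let [k1] be the first junction in direction [b]. The distinguished one is the last [k2] in
    direction [b] with [[k1, k2)] in [x b], or [k1] if there is none: anything beyond [k2] would be
    reached by extension. *)
Lemma distinguished_exists b k : 0 < k < n -> d k = b ->
  exists k, distinguished k /\ d k = b.
Proof.
move=> kn dk.
have ex1 : exists k, (0 < k < n) && (d k == b) by exists k; rewrite kn dk eqxx.
have [k1 /andP[k1n /eqP dk1] k1min] := ex_minnP ex1.
have [/existsP/= [[j jn] /= e]|] :=
    boolP [exists j : 'I_n, [&& k1 < j, d j == b & x b k1 j]]; last first.
  move/existsPn => h; exists k1; split=> //; split=> // [j kj jn|i i0 ik] e.
    by have := h (Ordinal jn); rewrite /= -dk1 e kj eqxx /=.
  have : k1 <= i; last arith.
  by apply: k1min; rewrite i0 -dk1 e eqxx andbT; arith.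
have ex2 : exists j, [&& k1 < j, j < n, d j == b & x b k1 j].
  by exists j; rewrite jn /=.
have ub2 j' : [&& k1 < j', j' < n, d j' == b & x b k1 j'] -> j' <= n.
  by case/and4P => _ /ltnW.
have [k2 /and4P[k12 k2n /eqP dk2 xk] k2max] := ex_maxnP ex2 ub2.
exists k2; split=> //; split=> [|l kl ln|i i0 ik]; rewrite ?dk2; first arith.
  move=> e'; apply/negP => xl; have : l <= k2; last arith.
  by apply: k2max; rewrite ln e' eqxx (x_extension _ _ _ _ xk xl) ?andbT; arith.
move=> e'; have k1i : k1 <= i by apply: k1min; rewrite i0 e' eqxx; arith.
by apply/negP => xi; apply: (x_clash _ _ xk xi); [arith..|sub].
Qed.

(** A smaller slice that keeps exactly one of the ends contradicts distinguishedness of that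
    junction; one that keeps neither is strict of the opposite type, so compatibility puts it in
    [x (~~ d k)]. *)
Lemma distinguished_minimal k k' i j : compatible ->
  distinguished k -> distinguished k' -> d k' = ~~ d k -> k < k' ->
  subslice (~~ d k) k k' i j -> x (d k) i j -> i = k /\ j = k'.
Proof.
move=> cp [/andP[k0 kn] fw bw] [/andP[k0' kn'] fw' bw'] e kk'.
move=> /and5P[ki ij jk' si sj] xij; rewrite negbK in sj.
have [ik|ik] := eqVneq i k; have [ejk'|jk] := eqVneq j k'; split=> //; subst.
- by rewrite (negbTE (fw _ _ _ _)) // in xij; [arith|apply: cut_neq sj jk].
- have := bw' i; rewrite e negbK (cut_neq si ik) xij => nx.
  by exfalso; suff: ~~ true by []; apply: nx; arith.
- have := x_disjoint (c := d k) (i := i) (j := j) xij; case.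
  by apply: cp; rewrite ?negbK; [arith..|apply: cut_neq si ik|apply: cut_neq sj jk].
- have := x_disjoint (c := d k) (i := i) (j := j) xij; case.
  by apply: cp; rewrite ?negbK; [arith..|apply: cut_neq si ik|apply: cut_neq sj jk].
Qed.

(** If [i < k], distinguishedness of [k] keeps [[i, k)] out of [x (~~ d k)], and the resulting
    witness contradicts the minimality of [[i, j)]. The other end is symmetric. *)
Lemma distinguished_maximal k k' i j :
  distinguished k -> distinguished k' -> d k' = ~~ d k -> k < k' ->
  0 < i -> i <= k -> k' <= j -> j < n -> d i = d k -> d j = ~~ d k ->
  (forall i' j', subslice (~~ d k) i j i' j' -> x (d k) i' j' ->
     i' = i /\ j' = j) ->
  i = k /\ j = k'.
Proof.
move=> [/andP[k0 kn] fw bw] [/andP[k0' kn'] fw' bw'] e kk' i0 ik k'j jn di dj mn.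
split.
  apply/eqP; rewrite eqn_leq ik leqNgt; apply/negP => {}ik.
  have [i' [j' [/and5P[ii' ij' jk' si sj] xij]]] := x_witness i0 ik kn (bw _ i0 ik di).
  rewrite !negbK in sj xij.
  have [|_ ej] := mn i' j' _ xij; last by arith.
  apply/and5P; split=> //; first by arith.
  by apply: cut_eq; rewrite negbK; apply: cut_dir sj.
apply/eqP; rewrite eqn_leq k'j andbT leqNgt; apply/negP => {}k'j.
have := fw' _ k'j jn; rewrite e => /(_ dj) nx.
have [i' [j' [/and5P[ii' ij' jk' si sj] xij]]] := x_witness k0' k'j jn nx.
rewrite !negbK in sj xij.
have [|ei _] := mn i' j' _ xij; last by arith.
apply/and5P; split=> //; rewrite ?negbK //; first by arith.
by apply: cut_eq; apply: cut_dir si.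
Qed.

(** Pieces ending by [k] are strict of the wrong type; pieces starting after [k], or straddling [k]
    and ending before [k'], contradict minimality of [[k, k')]. What remains is a proper extension
    of [[k, k')] to the left, which a label does not admit. *)
Lemma minimal_reaches k k' k2 i j : compatible ->
  0 < k2 -> k2 < k -> k < k' -> k' < n -> d k2 = ~~ d k -> d k' = ~~ d k ->
  (forall i' j', subslice (~~ d k) k k' i' j' -> x (d k) i' j' ->
     i' = k /\ j' = k') ->
  subslice (~~ d k) k2 k' i j -> x (d k) i j -> i < k /\ j = k'.
Proof.
move=> cp k20 k2k kk' kn dk2 dk' mn /and5P[k2i ij jk' si sj] xij.
rewrite negbK in sj; have di := cut_dir dk2 si.
have [jk|kj] := leqP j k.
  have [] := x_disjoint xij; apply: cp => //; [arith..|rewrite negbK].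
  by apply: cut_neq sj _; arith.
have [ki|ik] := leqP k i.
  have ki' : k < i by case: ltngtP ki di => // ->; case: (d i).
  have [|ei _] := mn i j _ xij; last by arith.
  by apply/and5P; split=> //; rewrite ?negbK //; apply: cut_eq.
split=> //; apply/eqP; apply: contraT => jk.
have dj := cut_neq sj jk.
have xkj : x (d k) k j by apply: (x_closed _ _ xij) => //; [arith..|sub].
have [|_ ej] := mn k j _ xkj; last by rewrite ej eqxx in jk.
by sub.
Qed.

End Junctions.

(** * Words and their slices *)

Definition origin : point := (0, 0)%R.
Definition slice (w : seq point) i j := drop i (take j w).
(** Meant for junctions [0 < k < size w], where in a word sorted by [se_step] the value [false]
    means a South step. *)
Definition turn w k := nth origin w k == east (nth origin w k.-1).
Definition fwd (c : bool) := if c then east else south.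
Definition bwd (c : bool) := if c then west else north.

Definition index_pairs (w : seq point) :=
  [seq (i, j) | i <- iota 0 (size w).+1, j <- iota 0 (size w).+1].

(** The [c]-slices of [w]: quotients for [c = true], subwords for [c = false]. Listing them over
    index pairs makes [occ] decidable. *)
Definition occs c w := [seq slice w ij.1 ij.2 | ij <- index_pairs w
  & subslice (turn w) c 0 (size w) ij.1 ij.2].
Definition occ c u w := u \in occs c w.

Definition strict c w i j :=
  [&& 0 < i, i < j, j < size w, turn w i == c & turn w j == ~~ c].
Definition soccs c w := [seq slice w ij.1 ij.2 | ij <- index_pairs w
  & strict c w ij.1 ij.2].

Lemma mem_index_pairs w i j : i <= size w -> j <= size w ->
  (i, j) \in index_pairs w.
Proof. by move=> iw jw; apply/allpairsP; exists (i, j); rewrite !mem_iota !ltnS iw jw. Qed.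

Lemma occP c u w : reflect
  (exists i j, subslice (turn w) c 0 (size w) i j /\ u = slice w i j) (occ c u w).
Proof.
apply: (iffP mapP) => [[[i j]]|[i [j [s ->]]]].
  by rewrite mem_filter => /andP[s _] ->; exists i, j.
exists (i, j) => //; rewrite mem_filter s /=; apply: mem_index_pairs;
  by case/and5P: s => *; arith.
Qed.

Lemma soccP c u w : reflect
  (exists i j, strict c w i j /\ u = slice w i j) (u \in soccs c w).
Proof.
apply: (iffP mapP) => [[[i j]]|[i [j [s ->]]]].
  by rewrite mem_filter => /andP[s _] ->; exists i, j.
exists (i, j) => //; rewrite mem_filter s /=; apply: mem_index_pairs;
  by case/and5P: s => *; arith.
Qed.

Lemma size_slice w i j : j <= size w -> size (slice w i j) = j - i.
Proof. by move=> jw; rewrite size_drop size_takel. Qed.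

Lemma nth_slice w i j k : i + k < j -> nth origin (slice w i j) k = nth origin w (i + k).
Proof. by move=> ikj; rewrite nth_drop nth_take. Qed.

Lemma slice_slice w i j a b : i + b <= j ->
  slice (slice w i j) a b = slice w (i + a) (i + b).
Proof. by move=> bj; rewrite /slice take_drop take_takel 1?addnC // drop_drop addnC. Qed.

Lemma slice0 w : slice w 0 (size w) = w.
Proof. by rewrite /slice drop0 take_size. Qed.

Lemma turn_slice w i j k : 0 < k -> i + k < j -> turn (slice w i j) k = turn w (i + k).
Proof.
move=> k0 kj; rewrite /turn !nth_slice //; last by arith.
by rewrite -!subn1 addnBA.
Qed.

Lemma slice_rcons w i j : i <= j -> j < size w ->
  slice w i j.+1 = rcons (slice w i j) (nth origin w j).
Proof.
move=> ij jw; rewrite /slice (take_nth origin) // -cats1 drop_cat size_takel; last by arith.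
case: ltngtP ij => // [_|->] _; first by rewrite cats1.
by rewrite subnn drop0 drop_oversize // size_takel // ltnW.
Qed.

Lemma slice_cons w i j : i < j -> j <= size w ->
  slice w i j = nth origin w i :: slice w i.+1 j.
Proof.
by move=> ij jw; rewrite /slice (drop_nth origin) ?nth_take // size_takel.
Qed.

Lemma slice_inj w i j i' j' : uniq w -> i < j -> j <= size w ->
  i' < j' -> j' <= size w -> slice w i j = slice w i' j' -> i = i' /\ j = j'.
Proof.
move=> uw ij jw ij' jw' e.
have := congr1 (fun s => nth origin s 0) e; rewrite !nth_slice ?addn0 // => /eqP.
rewrite nth_uniq //; [move=> /eqP ei|arith..].
by have := congr1 size e; rewrite !size_slice // ei; arith.
Qed.

Lemma subslice_trans d c i j i1 j1 i2 j2 :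
  subslice d c i j i1 j1 -> subslice d c i1 j1 i2 j2 -> subslice d c i j i2 j2.
Proof.
move=> /and5P[h1 h2 h3 c1 c2] /and5P[h4 h5 h6 c3 c4]; apply/and5P; split=> //.
- by apply: leq_trans h4.
- by apply: leq_trans h3.
- by move: c3 c1; rewrite /cut => /orP[/eqP->|/eqP->]; rewrite ?eqxx ?orbT.
- by move: c4 c2; rewrite /cut => /orP[/eqP->|/eqP->]; rewrite ?eqxx ?orbT.
Qed.

Lemma subslice_slice w c i j a b : i < j -> j <= size w ->
  subslice (turn (slice w i j)) c 0 (j - i) a b =
  subslice (turn w) c i j (i + a) (i + b).
Proof.
move=> ij jw; rewrite /subslice /= ltn_add2l leq_addr /=.
have [ab|] := ltnP a b; rewrite ?andbF //=.
have -> : (b <= j - i) = (i + b <= j) by arith.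
have [bj|] := leqP (i + b) j; rewrite ?andbF //=.
congr andb; rewrite /cut.
  have [->|a0] := posnP a; first by rewrite addn0 !eqxx.
  rewrite turn_slice //; [|arith].
  by have -> : (i + a == i) = false by arith.
have [->|nb] := eqVneq b (j - i); first by rewrite subnKC ?eqxx // ltnW.
have -> : (i + b == j) = false by arith.
by rewrite turn_slice //; arith.
Qed.

Lemma occ_sliceP c u w i j : i < j -> j <= size w -> reflect
  (exists i' j', subslice (turn w) c i j i' j' /\ u = slice w i' j')
  (occ c u (slice w i j)).
Proof.
move=> ij jw; apply: (iffP (occP _ _ _)); rewrite size_slice // => -[a [b [s ->]]].
  exists (i + a), (i + b); rewrite subslice_slice // in s; split=> //.
  by rewrite slice_slice //; case/and5P: s.
have /and5P[ia ab bj _ _] := s.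
exists (a - i), (b - i); rewrite subslice_slice // !subnKC //; last by arith.
by split=> //; rewrite slice_slice // !subnKC //; arith.
Qed.

Lemma occ_refl c w : w != [::] -> occ c w w.
Proof.
case: w => // v w _; apply/occP; exists 0, (size (v :: w)).
by rewrite slice0 /subslice /cut !eqxx !leqnn.
Qed.

Lemma occ_trans c u v w : occ c u v -> occ c v w -> occ c u w.
Proof.
move=> uv /occP[i [j [s e]]]; have /and5P[_ ij jw _ _] := s; subst v.
have /occ_sliceP := uv => /(_ ij jw) [a [b [s' ->]]].
by apply/occP; exists a, b; split=> //; apply: subslice_trans s s'.
Qed.

Lemma occ_size c u w : occ c u w -> size u <= size w.
Proof. by case/occP => i [j [/and5P[_ ij jw _ _] ->]]; rewrite size_slice //; arith. Qed.

Lemma occ_size_eq c u w : occ c u w -> size w <= size u -> u = w.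
Proof.
case/occP => i [j [/and5P[_ ij jw _ _] ->]]; rewrite size_slice // => h.
have -> : i = 0 by arith.
have -> : j = size w by arith.
exact: slice0.
Qed.

Lemma occ_anti c c' u w : occ c u w -> occ c' w u -> u = w.
Proof. by move=> o /occ_size; apply: occ_size_eq o. Qed.

Lemma occ_nil c u w : occ c u w -> u != [::].
Proof.
by case/occP => i [j [/and5P[_ ij jw _ _] ->]]; rewrite -size_eq0 size_slice //; arith.
Qed.

(** The points of [w] are distinct, so both occurrences are the same slice, and an end of it inside
    [w] would be crossed in two directions. *)
Lemma occ_both c u w : uniq w -> occ c u w -> occ (~~ c) u w -> u = w.
Proof.
move=> uw /occP[i [j [/and5P[_ ij jw ci cj] ->]]].
move=> /occP[i' [j' [/and5P[_ ij' jw' ci' cj'] e]]].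
have [? ?] := slice_inj uw ij jw ij' jw' e; subst i' j'.
have -> : i = 0.
  by apply/eqP; move: ci ci'; rewrite /cut; case: (i == 0); case: (turn w i); case: (c).
have -> : j = size w; last exact: slice0.
by apply/eqP; move: cj cj'; rewrite /cut; case: (j == _); case: (turn w j); case: (c).
Qed.

Lemma socc_occ c w u : u \in soccs c w -> occ c u w.
Proof.
case/soccP => i [j [/and5P[i0 ij jw ti tj] ->]]; apply/occP; exists i, j; split=> //.
by rewrite /subslice leq0n ij (ltnW jw) /cut ti tj !orbT.
Qed.

Lemma socc_trans c u v w : occ c u v -> v \in soccs c w -> u \in soccs c w.
Proof.
move=> uv /soccP[i [j [/and5P[i0 ij jw /eqP ti /eqP tj] e]]]; subst v.
have /occ_sliceP := uv => /(_ ij (ltnW jw)) [a [b [/and5P[ia ab bj ca cb] ->]]].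
apply/soccP; exists a, b; split=> //; apply/and5P; split=> //; first by arith.
- by arith.
- by rewrite (cut_dir ti ca).
- by rewrite (cut_dir tj cb).
Qed.

Lemma socc_nil c u w : u \in soccs c w -> u != [::].
Proof. by move/socc_occ/occ_nil. Qed.

(** * Trails in a shape *)

Lemma bwdK c v : bwd c (fwd c v) = v.
Proof. by case: v c => a b [] /=; rewrite /west /south /north /= ?addrK ?subrK. Qed.

Lemma fwdK c v : fwd c (bwd c v) = v.
Proof. by case: v c => a b [] /=; rewrite /east /south /= ?addrK ?subrK. Qed.

Lemma fwd_east c v : (fwd c v == east v) = c.
Proof.
case: v c => a b [] /=; first by rewrite eqxx.
by apply/eqP => -[] /eqP; rewrite -subr_eq0 opprD addNKr.
Qed.

Lemma se_step_fwd c v : se_step v (fwd c v).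
Proof. by rewrite /se_step; case: c; rewrite eqxx ?orbT. Qed.

Lemma nth_fwd w k : sorted se_step w -> 0 < k -> k < size w ->
  nth origin w k = fwd (turn w k) (nth origin w k.-1).
Proof.
case: k => // k /(sortedP origin) sw _ /sw; rewrite /se_step /turn /= orbC.
by case: eqP => //= _ /eqP.
Qed.

Lemma nth_bwd w k : sorted se_step w -> 0 < k -> k < size w ->
  nth origin w k.-1 = bwd (turn w k) (nth origin w k).
Proof. by move=> sw k0 kw; rewrite [in RHS]nth_fwd // bwdK. Qed.

Lemma slice_catm l w r i j : j <= size w ->
  slice (l ++ w ++ r) (size l + i) (size l + j) = slice w i j.
Proof.
move=> jw; rewrite /slice take_cat ltnNge leq_addr /= addKn takel_cat //.
by rewrite drop_cat ltnNge leq_addr /= addKn.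
Qed.

Lemma turn_catm l w r k : 0 < k -> k < size w -> turn (l ++ w ++ r) (size l + k) = turn w k.
Proof.
move=> k0 kw; have e i : i < size w -> nth origin (l ++ w ++ r) (size l + i) = nth origin w i.
  by move=> iw; rewrite nth_cat ltnNge leq_addr /= addKn nth_cat iw.
by rewrite /turn e // -subn1 -addnBA // e ?subn1 //; arith.
Qed.

Section Trails.
Variable lambda : grid_shape.
Local Notation interior := (interior lambda).
Local Notation boundary := (boundary lambda).
Local Notation is_path := (is_path lambda).
Local Notation is_segment := (is_segment lambda).

(** A path under construction: its end points may be interior or boundary, so it can still be
    extended at an interior end. *)
Record trail w : Prop := Trail {
  trail_sorted : sorted se_step w;
  trail_sub : {subset w <= lambda};
  trail_interior : forall i, 0 < i -> i.+1 < size w -> interior (nth origin w i) }.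

Lemma interior_sub v : interior v -> v \in lambda.
Proof. by case/and5P. Qed.

Lemma interior_fwd c v : interior v -> fwd c v \in lambda.
Proof. by case/and5P; case: c. Qed.

Lemma interior_bwd c v : interior v -> bwd c v \in lambda.
Proof. by case/and5P; case: c. Qed.

Lemma sorted_step_uniq w : sorted se_step w -> uniq w.
Proof. by case: w => // v w; apply: se_path_uniq. Qed.

Lemma trail_uniq w : trail w -> uniq w.
Proof. by case=> sw _ _; apply: sorted_step_uniq. Qed.

Lemma trail_size w : trail w -> size w <= #|` lambda|%fset.
Proof. by move=> tw; apply: uniq_leq_size; [apply: trail_uniq|apply: trail_sub]. Qed.

Lemma slice_sorted w i j : sorted se_step w -> sorted se_step (slice w i j).
Proof. by move=> sw; apply/drop_sorted/take_sorted. Qed.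

Lemma trail_segment w i j : trail w -> 0 < i -> i < j -> j < size w ->
  is_segment (slice w i j).
Proof.
move=> tw i0 ij jw; apply/and3P; split.
- by rewrite -size_eq0 size_slice; arith.
- apply/(all_nthP origin) => k; rewrite size_slice; last by arith.
  by move=> kij; rewrite nth_slice; [apply: (trail_interior tw)|]; arith.
- exact/slice_sorted/trail_sorted.
Qed.

Lemma segment_uniq w : is_segment w -> uniq w.
Proof. by case/and3P => _ _; apply: sorted_step_uniq. Qed.

Lemma segment_nil w : is_segment w -> w != [::].
Proof. by case/and3P. Qed.

Lemma segment_trail w : is_segment w -> trail w.
Proof.
case/and3P=> _ /allP iw sw; split=> // [v /iw/interior_sub//|i _ iw'].
by apply: iw; apply: mem_nth; apply: ltnW.
Qed.

Lemma occ_segment c u w : is_segment w -> occ c u w -> is_segment u.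
Proof.
move=> /and3P[_ iw sw] o; apply/and3P; split; first exact: occ_nil o.
  have /occP[i [j [_ ->]]] := o; apply/allP => v /mem_drop/mem_take.
  by apply/allP.
by have /occP[i [j [_ ->]]] := o; apply: slice_sorted.
Qed.

Lemma is_pathP w : reflect
  [/\ trail w, 1 < size w, boundary (nth origin w 0)
    & boundary (nth origin w (size w).-1)] (is_path w).
Proof.
case: w => [|v0 [|v1 w]]; try by apply: (iffP idP) => // -[].
have int_belast : all interior (belast v1 w) <->
    forall i, 0 < i -> i.+1 < size (v0 :: v1 :: w) -> interior (nth origin (v0 :: v1 :: w) i).
  have e i : i < size w -> nth origin (belast v1 w) i = nth origin (v1 :: w) i.
    by move=> iw; rewrite lastI nth_rcons size_belast iw.
  split=> [/(all_nthP origin) h [//|i] _ /= iw|h].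
    by have := h i; rewrite size_belast e; [apply|].
  apply/(all_nthP origin) => i; rewrite size_belast => iw; rewrite e //.
  exact: (h i.+1).
apply: (iffP and4P) => [[b0 bl /int_belast iw sw]|[[sw sub iw] _ b0 bl]].
  split=> //; last by rewrite /= nth_last.
  split=> // v; rewrite inE => /orP[/eqP->|]; first by case/andP: b0.
  rewrite lastI mem_rcons inE => /orP[/eqP->|]; first by case/andP: bl.
  move=> vw; apply: interior_sub; have /int_belast/allP := iw; exact.
by split=> //; [have := nth_last origin (v1 :: w); rewrite /= => <-|apply/int_belast].
Qed.

Lemma path_boundary p i : is_path p -> i < size p ->
  boundary (nth origin p i) = (i == 0) || (i.+1 == size p).
Proof.
move=> /is_pathP[tp p1 b0 bl] ip; have [->|i0] := posnP i; first exact: b0.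
have [e|ne] := eqVneq i.+1 (size p).
  by have -> : i = (size p).-1 by arith.
by rewrite /boundary (trail_interior tp) ?andbF //; arith.
Qed.

Lemma trail_rcons w c : trail w -> 1 < size w -> interior (last origin w) ->
  trail (rcons w (fwd c (last origin w))).
Proof.
move=> tw w1 il; split.
- by case: w tw {w1 il} => // v w [/= sw _ _]; rewrite rcons_path sw se_step_fwd.
- move=> v; rewrite mem_rcons inE => /orP[/eqP->|]; first exact: interior_fwd.
  exact: trail_sub.
- move=> i i0; rewrite size_rcons ltnS leq_eqVlt nth_rcons => /orP[/eqP e|iw].
    by rewrite -e leqnn; rewrite -nth_last -e in il.
  by rewrite (ltnW iw); apply: trail_interior.
Qed.

Lemma trail_cons w c : trail w -> 1 < size w -> interior (head origin w) ->
  trail (bwd c (head origin w) :: w).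
Proof.
move=> tw w1 il; split.
- case: w tw {w1 il} => // v w [/= sw _ _]; rewrite sw andbT.
  by rewrite -{2}(fwdK c v) se_step_fwd.
- move=> v; rewrite inE => /orP[/eqP->|]; first exact: interior_bwd.
  exact: trail_sub.
- move=> [|[|i]] // _ iw.
  by apply: (trail_interior tw (i := i.+1)).
Qed.

Lemma turn_rcons w y k : k < size w -> turn (rcons w y) k = turn w k.
Proof. by move=> kw; rewrite /turn !nth_rcons kw (leq_ltn_trans (leq_pred k) kw). Qed.

Lemma turn_rcons_last w c : 0 < size w ->
  turn (rcons w (fwd c (last origin w))) (size w) = c.
Proof.
move=> w0; rewrite /turn !nth_rcons ltnn eqxx prednK // leqnn nth_last.
exact: fwd_east.
Qed.

Lemma turn_cons w y k : 0 < k -> turn (y :: w) k.+1 = turn w k.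
Proof. by case: k. Qed.

Lemma turn_cons1 w c : turn (bwd c (head origin w) :: w) 1 = c.
Proof. by rewrite /turn /= nth0 -{1}(fwdK c (head _ _)) fwd_east. Qed.

Lemma slice_rconsl w y i j : j <= size w -> slice (rcons w y) i j = slice w i j.
Proof. by move=> jw; rewrite /slice -cats1 takel_cat. Qed.

End Trails.

(** * Torsion pairs and paths *)

Section Torsion.
Variable lambda : grid_shape.
Local Notation interior := (interior lambda).
Local Notation boundary := (boundary lambda).
Local Notation is_path := (is_path lambda).
Local Notation is_segment := (is_segment lambda).
Local Notation trail := (trail lambda).

(** Maximality is the field [torsion_witness]: a segment missing from one half has a piece in the
    other half. *)
Record torsion (X : bool -> pred (seq point)) : Prop := Torsion {
  torsion_segment : forall c w, X c w -> is_segment w;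
  torsion_closed : forall c u w, X c w -> occ c u w -> X c u;
  torsion_disjoint : forall c w, X c w -> X (~~ c) w -> False;
  torsion_witness : forall c w, is_segment w -> ~~ X c w ->
    exists2 u, occ c u w & X (~~ c) u }.

Definition good (X : bool -> pred (seq point)) p :=
  all (X true) (soccs true p) && all (X false) (soccs false p).

(** For [c = true], no proper subword of [u] is in [X true]; for [c = false], no proper quotient of
    [u] is in [X false]. *)
Definition minimal (X : bool -> pred (seq point)) c u :=
  X c u && all (fun v => X c v ==> (v == u)) (occs (~~ c) u).

Variable X : bool -> pred (seq point).
Definition on_slices w c i j := X c (slice w i j).
Local Notation xs := on_slices.
Local Notation dist w k := (distinguished (size w) (turn w) (xs w) k).

Lemma goodP p : reflect (forall c u, u \in soccs c p -> X c u) (good X p).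
Proof.
by apply: (iffP andP) => [[/allP ht /allP hf] []|h]; [..|split; apply/allP; apply: h].
Qed.

Lemma minimalP c u : reflect
  (X c u /\ forall v, occ (~~ c) v u -> X c v -> v = u) (minimal X c u).
Proof.
apply: (iffP andP) => -[xu h]; split=> //.
  by move=> v vu xv; apply/eqP; have /allP/(_ v vu)/implyP := h; apply.
by apply/allP => v vu; apply/implyP => xv; apply/eqP/h.
Qed.

Lemma good_compatible p : good X p -> compatible (size p) (turn p) (xs p).
Proof.
move=> /goodP h c i j i0 ij jp ti tj; apply: h; apply/soccP; exists i, j.
by rewrite /strict i0 ij jp ti tj !eqxx.
Qed.

Lemma compatible_good p : compatible (size p) (turn p) (xs p) -> good X p.
Proof.
move=> h; apply/goodP => c u /soccP[i [j [/and5P[i0 ij jp /eqP ti /eqP tj] ->]]].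
exact: h.
Qed.

(** While an end is interior, one point is added there. This stops with both ends on the boundary,
    because a trail has at most as many points as the shape. *)
Lemma extend_to_path w k : trail w -> 0 < k -> k < size w ->
  obeys (size w) (turn w) (xs w) k ->
  exists p l r, [/\ is_path p, p = l ++ w ++ r &
    obeys (size p) (turn p) (xs p) (size l + k)].
Proof.
have [m] := ubnP (#|` lambda|%fset.+1 - size w).
elim: m w k => // m IH w k; rewrite ltnS => hm tw k0 kw [fw bw].
have w1 : 1 < size w by arith.
have w0 : 0 < size w by arith.
have wl := trail_size tw.
have [il|nil] := boolP (interior (last origin w)).
  (* This is the only direction that [obeys] allows for a new last step; the new first step below is
     chosen in the same way. *)
  pose c := if X (turn w k) (slice w k (size w)) then ~~ turn w k else turn w k.
  have tw' := trail_rcons c tw w1 il.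
  have ob : obeys (size (rcons w (fwd c (last origin w))))
      (turn (rcons w (fwd c (last origin w)))) (xs (rcons w (fwd c (last origin w)))) k.
    rewrite size_rcons /on_slices; split=> [j kj|i i0 ik].
      rewrite ltnS leq_eqVlt => /orP[/eqP->|jw].
        rewrite turn_rcons_last // turn_rcons // slice_rconsl // /c.
        by case: ifP => _; rewrite ?eqxx //; case: (turn w k).
      by rewrite !turn_rcons // slice_rconsl ?fw // ltnW.
    have iw : i < size w by arith.
    by rewrite !turn_rcons // slice_rconsl ?bw // ltnW.
  have [||p [l [r [pp pe po]]]] := IH _ _ _ tw' k0 _ ob.
  - by rewrite size_rcons; arith.
  - by rewrite size_rcons; arith.
  by exists p, l, (fwd c (last origin w) :: r); rewrite -cat_rcons.
have [ih|nih] := boolP (interior (head origin w)).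
  pose c := if X (~~ turn w k) (slice w 0 k) then ~~ turn w k else turn w k.
  have tw' := trail_cons c tw w1 ih.
  set y := bwd c _ in tw'.
  have ob : obeys (size (y :: w)) (turn (y :: w)) (xs (y :: w)) k.+1.
    rewrite /obeys /on_slices turn_cons //; split=> [[|j] //|[//|i] _].
      rewrite ltnS => kj /=; rewrite ltnS => jw.
      by rewrite turn_cons; [exact: fw|arith].
    rewrite ltnS => ik; have [->|i0] := posnP i; last by rewrite turn_cons //; exact: bw.
    rewrite turn_cons1 /c -[slice (y :: w) 1 k.+1]/(slice w 0 k).
    by case: ifP => _; rewrite ?eqxx //; case: (turn w k).
  have [||p [l [r [pp pe po]]]] := IH _ _ _ tw' (ltn0Sn k) _ ob.
  - by rewrite -[size (y :: w)]/(size w).+1; arith.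
  - by rewrite /= ltnS.
  exists p, (rcons l y), r; rewrite pe cat_rcons; split=> //; first by rewrite -pe.
  by rewrite size_rcons addSnnS -pe.
exists w, [::], [::]; rewrite cats0 add0n; split=> //.
apply/is_pathP; split=> //; rewrite /boundary.
  by rewrite nth0 nih andbT (trail_sub tw) // -nth0 mem_nth.
rewrite nth_last nil andbT; apply: (trail_sub tw).
by rewrite -nth_last mem_nth // prednK.
Qed.

Hypothesis tX : torsion X.

Lemma slices_closed w : trail w -> forall c i j i' j',
  0 < i -> j < size w -> xs w c i j -> subslice (turn w) c i j i' j' -> xs w c i' j'.
Proof.
move=> tw c i j i' j' i0 jw xw s.
have ij : i < j by case/and5P: s => *; arith.
by apply: (torsion_closed tX xw); apply/(occ_sliceP _ _ ij (ltnW jw)); exists i', j'.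
Qed.

Lemma slices_disjoint w c i j : xs w c i j -> xs w (~~ c) i j -> False.
Proof. exact: (torsion_disjoint tX). Qed.

Lemma slices_witness w : trail w -> forall c i j,
  0 < i -> i < j -> j < size w -> ~~ xs w c i j ->
  exists i' j', subslice (turn w) c i j i' j' /\ xs w (~~ c) i' j'.
Proof.
move=> tw c i j i0 ij jw nx.
have [u ou xu] := torsion_witness tX (trail_segment tw i0 ij jw) nx.
have /occ_sliceP := ou => /(_ ij (ltnW jw)) [i' [j' [s e]]].
by exists i', j'; rewrite /on_slices -e.
Qed.

Lemma obeys_good p k : is_path p -> 0 < k -> k < size p ->
  obeys (size p) (turn p) (xs p) k -> good X p /\ dist p k.
Proof.
move=> /is_pathP[tp _ _ _] k0 kp ob; split; last by apply: obeys_distinguished; rewrite ?k0.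
apply: compatible_good.
exact: (obeys_compatible (slices_closed tp) (@slices_disjoint p) (slices_witness tp)) ob.
Qed.

Lemma minimal_exists c w : X c w -> exists2 u, occ (~~ c) u w & minimal X c u.
Proof.
have [m] := ubnP (size w); elim: m w => // m IH w; rewrite ltnS => hm xw.
have w0 := segment_nil (torsion_segment tX xw).
have [h|] := boolP (all (fun v => X c v ==> (v == w)) (occs (~~ c) w)).
  by exists w; rewrite ?occ_refl // /minimal xw.
move=> /allPn[v vw]; rewrite negb_imply => /andP[xv nvw].
have [|u uv mu] := IH v _ xv.
  apply: leq_trans hm; rewrite ltnNge; apply: contra nvw => sz.
  by apply/eqP; apply: occ_size_eq vw sz.
by exists u => //; apply: occ_trans vw.
Qed.

(** Put a step in direction [c] before [u] and one in direction [~~ c] after it. Minimality says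
    that this word obeys at its first junction, so it extends to a path. *)
Lemma minimal_path c u : minimal X c u -> exists p k k',
  [/\ is_path p, good X p, strict c p k k', u = slice p k k' & dist p k].
Proof.
move=> /minimalP[xu mu]; have su := torsion_segment tX xu.
have tu := segment_trail su; have u0 : 0 < size u.
  by rewrite lt0n size_eq0 (segment_nil su).
have iu v : v \in u -> interior v by case/and3P: su => _ /allP iu _ /iu.
have hu : head origin u \in u by rewrite -nth0 mem_nth.
have lu : last origin u \in u by rewrite -nth_last mem_nth // prednK.
pose w := bwd c (head origin u) :: rcons u (fwd (~~ c) (last origin u)).
have sw : size w = (size u).+2 by rewrite /= size_rcons.
have hw : head origin (rcons u (fwd (~~ c) (last origin u))) = head origin u.
  by case: (u) u0.
have t1 : turn w 1 = c by rewrite /w -hw turn_cons1.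
have tl : turn w (size u).+1 = ~~ c by rewrite turn_cons // turn_rcons_last.
have ti i : 0 < i -> i < size u -> turn w i.+1 = turn u i.
  by move=> i0 iu'; rewrite turn_cons // turn_rcons.
have sl i j : j <= size u -> slice w i.+1 j.+1 = slice u i j.
  by move=> ju; rewrite -[LHS]/(slice (rcons u _) i j) slice_rconsl.
have tw : trail w.
  split.
  - rewrite /w /= rcons_path; case: (u) u0 (trail_sorted tu) => //= v s _ ->.
    by rewrite se_step_fwd -{2}(fwdK c v) se_step_fwd.
  - move=> v; rewrite inE mem_rcons inE => /or3P[/eqP->|/eqP->|/iu/interior_sub//].
      exact/interior_bwd/iu.
    exact/interior_fwd/iu.
  - move=> [//|i] _; rewrite sw /= ltnS ltnS => iu'.
    by rewrite nth_rcons iu' iu ?mem_nth.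
(* At a junction of [u] in direction [~~ c], the part of [u] before it is a [c]-slice, hence in
   [X c]; in direction [c] it is a proper [~~ c]-slice, which minimality excludes from [X c]. *)
have ob : obeys (size w) (turn w) (xs w) 1.
  rewrite /obeys /on_slices t1; split=> [[|[|j]] // _|[|i] //]; rewrite sw !ltnS => ju.
  rewrite sl //.
  have [e|ne] := eqVneq j.+1 (size u).
    by rewrite e slice0 tl eqxx xu.
  have {ne}ju : j.+1 < size u by arith.
  rewrite ti //; have [tj|tj] := eqVneq (turn u j.+1) (~~ c).
    symmetry; apply: (torsion_closed tX xu); apply/occP; exists 0, j.+1; split=> //.
    by rewrite /subslice cutxx (cut_eq _ tj) (ltnW ju).
  apply/esym/negbTE/negP => xj.
  have : slice u 0 j.+1 = u.
    apply: mu => //; apply/occP; exists 0, j.+1; split=> //.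
    by rewrite /subslice cutxx (cut_eq _ (negb_neq tj)) (ltnW ju).
  by move/(congr1 size); rewrite size_slice ?(ltnW ju) //; arith.
have w1 : 1 < size w by rewrite sw.
have [p [l [r [pp pe po]]]] := extend_to_path (k := 1) tw isT w1 ob.
have pw : size l + size w <= size p by rewrite pe !size_cat addnA leq_addr.
have [gp dp] : good X p /\ dist p (size l + 1) by apply: obeys_good po => //; arith.
exists p, (size l + 1), (size l + (size u).+1); split=> //.
  rewrite /strict pe !turn_catm ?t1 ?tl ?sw ?eqxx ?andbT //.
  by rewrite !size_cat /= size_rcons; arith.
by rewrite pe slice_catm ?sw // sl ?slice0.
Qed.

(** A word of two points has a single junction, so [obeys] is vacuous there and the edge extends to
    a path. *)
Lemma edge_path b v : v \in lambda -> fwd b v \in lambda -> exists p k,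
  [/\ is_path p, good X p, dist p k, nth origin p k.-1 = v & nth origin p k = fwd b v].
Proof.
move=> vl fl; pose w := [:: v; fwd b v].
have tw : trail w.
  split; first by rewrite /= se_step_fwd.
    by move=> x; rewrite !inE => /orP[]/eqP->.
  by move=> [|[|i]].
have ob : obeys (size w) (turn w) (xs w) 1 by split=> [[|[|j]]|[|i]].
have [p [l [r [pp pe po]]]] := extend_to_path (k := 1) tw isT isT ob.
have pw : size l + size w <= size p by rewrite pe !size_cat addnA leq_addr.
rewrite /= in pw.
have [gp dp] : good X p /\ dist p (size l + 1) by apply: obeys_good po => //; arith.
exists p, (size l + 1); split=> //; rewrite pe ?addn1 /= nth_cat.
  by rewrite ltnn subnn.
by rewrite ltnNge leqnSn /= subSnn.
Qed.

End Torsion.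

(** * Two paths that share a slice *)

Lemma slice_sub p q i j i' j' a b a' b' :
  slice p i j = slice q i' j' -> a = i + (a' - i') -> b = i + (b' - i') ->
  i' <= a' -> i' <= b' -> b' <= j' -> b <= j ->
  slice p a b = slice q a' b'.
Proof.
move=> e -> -> ia ib bj bj'; rewrite -(slice_slice _ _ bj') e slice_slice; last by arith.
by rewrite !subnKC.
Qed.

Section Coincide.
Variable lambda : grid_shape.
Variables (p r : seq point) (k k' l l' : nat).
(** The bounds [1 < k'] and [k.+1 < size p] keep the last point of the slice from being the start of
    the path, and its first point from being the end. A boundary point met to the right is thus the
    end of the path, and one met to the left its start. *)
Hypotheses (pp : is_path lambda p) (pr : is_path lambda r).
Hypotheses (kk' : k < k') (k'1 : 1 < k') (k'p : k' <= size p) (k1p : k.+1 < size p).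
Hypotheses (ll' : l < l') (l'1 : 1 < l') (l'r : l' <= size r) (l1r : l.+1 < size r).
Hypothesis pr_slice : slice p k k' = slice r l l'.

Lemma coincide_width : k' - k = l' - l.
Proof. by have := congr1 size pr_slice; rewrite !size_slice. Qed.

Let sp := let: Trail s _ _ := let: And4 t _ _ _ := elimT (is_pathP _ _) pp in t in s.
Let sr := let: Trail s _ _ := let: And4 t _ _ _ := elimT (is_pathP _ _) pr in t in s.

(** Walking on from the common slice, the two paths stay at the same point as long as their turns
    agree. A path stops exactly when it meets the boundary, so they also stop together. *)
Lemma coincide_right :
  (forall m, k' + m < size p -> l' + m < size r ->
     slice p k (k' + m) = slice r l (l' + m) -> turn p (k' + m) = turn r (l' + m)) ->
  drop k p = drop l r.
Proof.
move=> tpr; have w := coincide_width.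
have last_eq m : k' + m <= size p -> l' + m <= size r ->
    slice p k (k' + m) = slice r l (l' + m) ->
    nth origin p (k' + m).-1 = nth origin r (l' + m).-1.
  move=> mp mr e; have := congr1 (nth origin ^~ (k' + m - k).-1) e.
  rewrite !nth_slice; [|arith..].
  by have [-> ->] : k + (k' + m - k).-1 = (k' + m).-1 /\
    l + (k' + m - k).-1 = (l' + m).-1 by arith.
have step m : k' + m <= size p ->
    l' + m <= size r /\ slice p k (k' + m) = slice r l (l' + m).
  elim: m => [|m IH]; first by rewrite !addn0.
  rewrite !addnS => mp; have [|mr e] := IH; first exact: ltnW.
  have le := last_eq m (ltnW mp) mr e.
  have {}mr : l' + m < size r.
    rewrite ltn_neqAle mr andbT; apply/eqP => er.
    have := path_boundary pr (i := (l' + m).-1); rewrite -le path_boundary //; last by arith.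
    by move/(_ _)/esym; rewrite !prednK -?er ?eqxx ?orbT; arith.
  split=> //; rewrite !slice_rcons ?e; [congr rcons|arith..].
  by rewrite (nth_fwd sp) 1?(nth_fwd sr) ?le ?tpr //; arith.
have := step (size p - k'); rewrite subnKC // => /(_ (leqnn _))[mr e].
have er : size r = l' + (size p - k').
  have := path_boundary pr (i := (l' + (size p - k')).-1).
  rewrite -last_eq ?subnKC // path_boundary //; last by arith.
  by move/(_ _)/esym; rewrite !prednK ?eqxx ?orbT; arith.
by move: e; rewrite /slice -er !take_size.
Qed.

Lemma coincide_left :
  (forall m, m < k -> m < l ->
     slice p (k - m) k' = slice r (l - m) l' -> turn p (k - m) = turn r (l - m)) ->
  k = l /\ take k' p = take l' r.
Proof.
move=> tpr; have w := coincide_width.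
have head_eq m : m <= k -> m <= l -> slice p (k - m) k' = slice r (l - m) l' ->
    nth origin p (k - m) = nth origin r (l - m).
  move=> mk ml e; have := congr1 (nth origin ^~ 0) e.
  by rewrite !nth_slice ?addn0 //; arith.
have step m : m <= k -> m <= l /\ slice p (k - m) k' = slice r (l - m) l'.
  elim: m => [|m IH] mk; first by rewrite !subn0.
  have [|ml e] := IH; first exact: ltnW.
  have he := head_eq m (ltnW mk) ml e.
  have {}ml : m < l.
    rewrite ltn_neqAle ml andbT; apply/eqP => em.
    have := path_boundary pr (i := l - m); rewrite -he path_boundary //; last by arith.
    by move/(_ _)/esym; rewrite em subnn eqxx /=; arith.
  split=> //; rewrite (slice_cons (i := k - m.+1)) 1?(slice_cons (i := l - m.+1)); try arith.
  have -> : (k - m.+1).+1 = k - m by arith.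
  have -> : (l - m.+1).+1 = l - m by arith.
  rewrite e; congr cons.
  have -> : k - m.+1 = (k - m).-1 by arith.
  have -> : l - m.+1 = (l - m).-1 by arith.
  by rewrite (nth_bwd sp) 1?(nth_bwd sr) ?he ?tpr //; arith.
have [kl e] := step k (leqnn k).
have ekl : k = l.
  have := path_boundary pr (i := l - k); rewrite -head_eq // path_boundary //; last by arith.
  by move/(_ _)/esym; rewrite subnn eqxx /=; arith.
by split=> //; move: e; rewrite ekl !subnn /slice !drop0.
Qed.

Lemma coincide :
  (forall m, k' + m < size p -> l' + m < size r ->
     slice p k (k' + m) = slice r l (l' + m) -> turn p (k' + m) = turn r (l' + m)) ->
  (forall m, m < k -> m < l ->
     slice p (k - m) k' = slice r (l - m) l' -> turn p (k - m) = turn r (l - m)) ->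
  p = r.
Proof.
move=> /coincide_right dr /coincide_left[ekl tl]; have w := coincide_width.
have ekl' : k' = l' by arith.
rewrite -(cat_take_drop k' p) -(cat_take_drop k' r) {1}tl -ekl'; congr cat.
by rewrite -(subnK (ltnW kk')) -!drop_drop dr ekl.
Qed.

End Coincide.

(** * Labels *)

Section Labels.
Variables (lambda : grid_shape) (X : bool -> pred (seq point)).
Hypothesis tX : torsion lambda X.
Local Notation is_path := (is_path lambda).
Local Notation xs := (on_slices X).
Local Notation dist w k := (distinguished (size w) (turn w) (xs w) k).

Definition is_label c s : Prop :=
  minimal X c s /\ forall t, minimal X c t -> occ c s t -> t = s.

Lemma good_strict p c i j : good X p -> strict c p i j -> X c (slice p i j).
Proof. by move=> /goodP g s; apply: g; apply/soccP; exists i, j. Qed.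

Lemma good_obeys p k : good X p -> dist p k -> obeys (size p) (turn p) (xs p) k.
Proof. by move=> /good_compatible; apply: distinguished_obeys. Qed.

Lemma path_trail p : is_path p -> trail lambda p.
Proof. by case/is_pathP. Qed.

(** Both paths obey [X] at the shared edge, so as long as they agree their next turns are dictated
    by the same slice. *)
Lemma same_edge_path p r k l : is_path p -> is_path r -> good X p -> good X r ->
  dist p k -> dist r l -> turn p k = turn r l ->
  nth origin p k.-1 = nth origin r l.-1 -> p = r.
Proof.
move=> pp pr gp gr dk dl e ev.
have [/andP[k0 kp] _ _] := dk; have [/andP[l0 lr] _ _] := dl.
have [fp bp] := good_obeys gp dk; have [fr br] := good_obeys gr dl.
have sp := trail_sorted (path_trail pp); have sr := trail_sorted (path_trail pr).
have ee : slice p k.-1 k.+1 = slice r l.-1 l.+1.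
  rewrite !(@slice_cons _ _.-1) ?prednK //; try arith.
  rewrite (@slice_cons _ k) 1?(@slice_cons _ l) //.
  rewrite (nth_fwd (k := k) sp) // (nth_fwd (k := l) sr) // e ev.
  by rewrite /slice !drop_oversize ?size_takel.
apply: (coincide pp pr _ _ _ _ _ _ _ _ ee); [arith..| |].
  move=> m mp mr es.
  have es' : slice p k (k.+1 + m) = slice r l (l.+1 + m) by apply: slice_sub es _ _ _ _ _ _; arith.
  have h1 : k < k.+1 + m by arith.
  have h2 : l < l.+1 + m by arith.
  have := fp _ h1 mp; have := fr _ h2 mr; rewrite /on_slices es' e => <-.
  by move: (turn p _) (turn r _) (turn r l) => [] [] [].
move=> m mk ml es.
have es' : slice p (k.-1 - m) k = slice r (l.-1 - m) l by apply: slice_sub es _ _ _ _ _ _; arith.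
have h1 : 0 < k.-1 - m < k by arith.
have h2 : 0 < l.-1 - m < l by arith.
have /andP[h10 h1k] := h1; have /andP[h20 h2l] := h2.
have := bp _ h10 h1k; have := br _ h20 h2l; rewrite /on_slices es' e => <-.
by move: (turn p _) (turn r _) (turn r l) => [] [] [].
Qed.

(** Where the paths first part, the slice of [r] from the parting to one of the two ends of the
    common slice is strict, hence in [X] because [r] is good. In [p] the same slice is forbidden by
    distinguishedness of [k] or [k']. *)
Lemma same_slice_path p r k k' l l' : is_path p -> is_path r -> good X p -> good X r ->
  dist p k -> dist p k' -> turn p k' = ~~ turn p k -> k < k' ->
  strict (turn p k) r l l' -> slice p k k' = slice r l l' -> p = r.
Proof.
move=> pp pr gp gr dk dk' ek kk' /and5P[l0 ll' lr /eqP tl /eqP tl'] es.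
have [/andP[k0 kp] fk bk] := dk; have [/andP[k0' kp'] fk' bk'] := dk'.
have good_r c i j : 0 < i -> i < j -> j < size r -> turn r i = c ->
    turn r j = ~~ c -> X c (slice r i j).
  by move=> i0 ij jr ti tj; apply: good_strict => //; rewrite /strict i0 ij jr ti tj !eqxx.
have w := coincide_width (ltnW kp') (ltnW lr) es.
apply: (coincide pp pr _ _ _ _ _ _ _ _ es); [arith..| |].
  case=> [|m]; first by rewrite !addn0 ek tl'.
  move=> mp mr e; have [//|ne] := eqVneq (turn p (k' + m.+1)) (turn r (l' + m.+1)).
  exfalso; have [tp|/negb_neq tp] := eqVneq (turn p (k' + m.+1)) (turn p k).
    have h : k < k' + m.+1 by arith.
    case/negP: (fk _ h mp tp); rewrite /on_slices e; apply: good_r => //; first by arith.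
    by rewrite -tp; move: ne; case: (turn p _); case: (turn r _).
  have h : k' < k' + m.+1 by arith.
  rewrite -ek in tp; case/negP: (fk' _ h mp tp); rewrite /on_slices.
  have -> : slice p k' (k' + m.+1) = slice r l' (l' + m.+1).
    by apply: slice_sub e _ _ _ _ _ _; arith.
  rewrite ek; apply: good_r => //; [arith..|].
  by move: ne; rewrite tp ek; case: (turn p k); case: (turn r _).
case=> [|m]; first by rewrite !subn0 tl.
move=> mp mr e; have [//|ne] := eqVneq (turn p (k - m.+1)) (turn r (l - m.+1)).
exfalso; have [h1 h2] : 0 < k - m.+1 /\ k - m.+1 < k by arith.
have [tp|/negb_neq tp] := eqVneq (turn p (k - m.+1)) (turn p k).
  case/negP: (bk _ h1 h2 tp); rewrite /on_slices.
  have -> : slice p (k - m.+1) k = slice r (l - m.+1) l.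
    by apply: slice_sub e _ _ _ _ _ _; arith.
  apply: good_r; rewrite ?negbK //; [arith..|].
  by rewrite -tp; move: ne; case: (turn p _); case: (turn r _).
rewrite -ek in tp; case/negP: (bk' _ h1 (ltn_trans h2 kk') tp); rewrite /on_slices e ek negbK.
apply: good_r => //; [arith..|].
by move: ne; rewrite tp ek; case: (turn p k); case: (turn r _).
Qed.

Lemma minimal_slice p c i j : i < j -> j <= size p -> minimal X c (slice p i j) ->
  uniq p -> forall i' j', subslice (turn p) (~~ c) i j i' j' -> xs p c i' j' -> i' = i /\ j' = j.
Proof.
move=> ij jp /minimalP[_ mn] up i' j' s xij.
have /and5P[ii' ij' jj' _ _] := s.
apply: (slice_inj up) => //; first by apply: leq_trans jp.
by apply: mn => //; apply/(occ_sliceP _ _ ij jp); exists i', j'.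
Qed.

(** A minimal word [t] having this slice as a [c]-slice, for [c = turn p k], lies on a good path [r]
    by [minimal_path]. Then [r = p] by [same_slice_path], and [distinguished_maximal] applies within
    [p]. *)
Lemma distinguished_label p k k' : is_path p -> good X p -> dist p k -> dist p k' ->
  turn p k' = ~~ turn p k -> k < k' -> is_label (turn p k) (slice p k k').
Proof.
move=> pp gp dk dk' ek kk'; have tp := path_trail pp.
have [/andP[k0 kp] _ _] := dk; have [/andP[k0' kp'] _ _] := dk'.
have cp := good_compatible gp.
have sk : strict (turn p k) p k k' by rewrite /strict k0 kk' kp' ek !eqxx.
have mk : minimal X (turn p k) (slice p k k').
  apply/minimalP; split; first exact: good_strict sk.
  move=> v /(occ_sliceP _ _ kk' (ltnW kp'))[i [j [s ->]]] xij.
  by have [-> ->] := distinguished_minimal (@slices_disjoint _ _ tX p) cp dk dk' ek kk' s xij.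
split=> // t mt st; have [r [l [l' [pr gr sl et dl]]]] := minimal_path tX mt.
have /and5P[l0 ll' lr /eqP tl /eqP tl'] := sl.
move: st; rewrite et => /(occ_sliceP _ _ ll' (ltnW lr))[i [j [/and5P[li ij jl si sj] e]]].
have epr : p = r.
  apply: (same_slice_path pp pr gp gr dk dk' ek kk' (l := i) (l' := j)) => //.
  apply/and5P; split=> //; [arith..| |].
    by rewrite (cut_dir tl si).
  by rewrite (cut_dir tl' sj).
subst r; have [ei ej] := slice_inj (trail_uniq tp) kk' (ltnW kp') ij (leq_trans jl (ltnW lr)) e.
subst i j.
have [|-> ->] // := distinguished_maximal (slices_witness tX tp) dk dk' ek kk'
  l0 li jl lr tl tl' _.
by apply: minimal_slice => //; [exact: ltnW|rewrite -et|apply: trail_uniq tp].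
Qed.

(** [minimal_path] gives a path where [s] starts at a distinguished [k]; let [k2] be the
    distinguished junction in direction [~~ c]. If [k < k2], then [[k, k2)] is a label comparable
    with [s], hence equal to it. If [k2 < k], then [s] is a proper [c]-slice of a minimal word,
    which a label is not. *)
Lemma label_path c s : is_label c s -> exists p k k',
  [/\ is_path p, good X p, dist p k & dist p k'] /\
  [/\ turn p k = c, turn p k' = ~~ c, k < k' & s = slice p k k'].
Proof.
move=> [ms mx]; have [p [k [k' [pp gp sk es dk]]]] := minimal_path tX ms.
have tp := path_trail pp; have up := trail_uniq tp.
have /and5P[k0 kk' kp /eqP tk /eqP tk'] := sk.
have k'p : 0 < k' < size p by rewrite kp (ltn_trans k0).
have [k2 [dk2 tk2]] := distinguished_exists (slices_closed tX tp)
  (@slices_disjoint _ _ tX p) (slices_witness tX tp) k'p tk'.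
have [/andP[k20 k2p] fk2 bk2] := dk2.
have cp := good_compatible gp.
have [kk2|] := ltnP k k2.
  have [m2 x2] : is_label c (slice p k k2).
    by rewrite -tk; apply: distinguished_label => //; rewrite tk2 tk.
  have es2 : slice p k k2 = s.
    have [k2k'|k'k2] := leqP k' k2.
      apply: mx => //; rewrite es; apply/(occ_sliceP _ _ kk2 (ltnW k2p)); exists k, k'.
      by rewrite /subslice leqnn kk' k2k' cutxx (cut_eq _ tk').
    apply/esym/x2 => //; rewrite es; apply/(occ_sliceP _ _ kk' (ltnW kp)); exists k, k2.
    by rewrite /subslice leqnn kk2 (ltnW k'k2) cutxx (cut_eq _ tk2).
  by exists p, k, k2.
rewrite leq_eqVlt => /orP[/eqP e|k2k].
  by move: tk2; rewrite e tk; case: (c).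
have nx : ~~ xs p (~~ c) k2 k'.
  by have := fk2 k'; rewrite tk2 tk'; apply=> //; arith.
have [i [j [s1 x1]]] := slices_witness tX tp k20 (ltn_trans k2k kk') kp nx.
rewrite negbK in x1; have [u u1 mu] := minimal_exists tX x1.
have o1 : occ (~~ c) u (slice p k2 k').
  apply: occ_trans u1 _; apply/(occ_sliceP _ _ (ltn_trans k2k kk') (ltnW kp)).
  by exists i, j.
have /(occ_sliceP _ _ (ltn_trans k2k kk') (ltnW kp))[i' [j' [s2 eu]]] := o1.
have xu : xs p c i' j' by rewrite /on_slices -eu; have /minimalP[] := mu.
have mk : forall a b, subslice (turn p) (~~ c) k k' a b -> xs p c a b -> a = k /\ b = k'.
  by apply: minimal_slice => //; rewrite -?es //; apply: ltnW.
rewrite -tk in mk tk2 tk' s2 xu.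
have [ik ej] := minimal_reaches (slices_closed tX tp) (@slices_disjoint _ _ tX p)
  cp k20 k2k kk' kp tk2 tk' mk s2 xu.
subst j'.
have : u = s.
  apply: mx => //; rewrite eu es; apply/(occ_sliceP _ _ (ltn_trans ik kk') (ltnW kp)).
  by exists k, k'; rewrite /subslice leqnn kk' (ltnW ik) cutxx (cut_eq _ tk).
rewrite eu es => /slice_inj e; have [] := e up _ (ltnW kp) _ (ltnW kp); arith.
Qed.

Lemma strict_label_distinguished c p k k' : is_path p -> good X p ->
  is_label c (slice p k k') -> strict c p k k' -> dist p k /\ dist p k'.
Proof.
move=> pp gp /label_path[r [l [l' [[pr gr dl dl'] [tl tl' ll' es]]]]] sk.
have epr : r = p by apply: same_slice_path pr pp gr gp dl dl' _ ll' _ (esym es); rewrite tl.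
subst r; have /and5P[_ kk' kp _ _] := sk.
have [/andP[_ lp] _ _] := dl'.
by have [-> ->] := slice_inj (trail_uniq (path_trail pp)) kk' (ltnW kp) ll' (ltnW lp) es.
Qed.

End Labels.

(** * Torsion pairs as sets of segments *)

Section Words.
Variable lambda : grid_shape.
Implicit Types (p q s t f : word lambda) (Q A B F : {set word lambda}).
Local Notation is_path := (is_path lambda).
Local Notation is_segment := (is_segment lambda).

Definition words A : pred (seq point) := fun w => [exists t in A, pts t == w].

Lemma pts_inj : injective (@pts lambda).
Proof. by move=> p q /(inj_map val_inj) e; apply: val_inj. Qed.

Lemma wordsP A w : reflect (exists2 t, t \in A & pts t = w) (words A w).
Proof.
apply: (iffP existsP) => [[t /andP[tA /eqP <-]]|[t tA <-]]; first by exists t.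
by exists t; rewrite tA eqxx.
Qed.

Lemma words_pts A t : words A (pts t) = (t \in A).
Proof.
apply/wordsP/idP => [[u uA /pts_inj <-]//|tA]; by exists t.
Qed.

Lemma words_sub A B w : A \subset B -> words A w -> words B w.
Proof. by move=> /subsetP AB /wordsP[t /AB tB <-]; rewrite words_pts. Qed.

Definition segs : {set word lambda} := [set s | is_segment (pts s)].

Lemma words_segs w : words segs w = is_segment w.
Proof.
apply/wordsP/idP => [[t]|sw]; first by rewrite inE => st <-.
by have [t e] := segment_word sw; exists t => //; rewrite inE e.
Qed.

(** For [c = true], the common word is the image of a morphism from [w] to [v]; for [c = false], of
    one from [v] to [w]. *)
Definition has_hom c (w v : seq point) := has (fun u => occ (~~ c) u v) (occs c w).

Lemma homP c w v : reflect (exists2 u, occ c u w & occ (~~ c) u v) (has_hom c w v).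
Proof. exact: hasP. Qed.

Lemma homC c w v : has_hom (~~ c) w v = has_hom c v w.
Proof.
by apply/homP/homP => -[u o1 o2]; exists u; rewrite ?negbK // in o1 o2 *.
Qed.

Definition perp c Q := [set f in segs | [forall t in Q, ~~ has_hom c (pts t) (pts f)]].

Lemma perpP c Q f : reflect (f \in segs /\ {in Q, forall t, ~~ has_hom c (pts t) (pts f)})
  (f \in perp c Q).
Proof.
apply: (iffP setIdP) => -[fs h]; split=> //.
  by move=> t tQ; have /forall_inP := h; apply.
by apply/forall_inP.
Qed.

(** The torsion pair whose half [c] is the smallest one containing [Q], obtained as a double
    orthogonal. *)
Definition gen c Q : bool -> {set word lambda} :=
  fun b => if b == c then perp (~~ c) (perp c Q) else perp c Q.

Lemma gen_eq c Q : gen c Q c = perp (~~ c) (perp c Q).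
Proof. by rewrite /gen eqxx. Qed.

Lemma gen_neq c Q : gen c Q (~~ c) = perp c Q.
Proof. by rewrite /gen; case: c. Qed.

Definition torsion_pair (X : bool -> {set word lambda}) :=
  torsion lambda (fun c => words (X c)).

Lemma perp_segs c Q : perp c Q \subset segs.
Proof. by apply/subsetP => f /perpP[]. Qed.

Lemma perp_closed c Q u f : f \in perp c Q -> occ (~~ c) (pts u) (pts f) -> u \in perp c Q.
Proof.
move=> /perpP[fs h] o; apply/perpP; split.
  by move: fs; rewrite !inE => /occ_segment; apply; exact: o.
move=> t /h; apply: contra => /homP[v o1 o2].
by apply/homP; exists v => //; apply: occ_trans o2 o.
Qed.

Lemma sub_gen c Q : Q \subset segs -> Q \subset gen c Q c.
Proof.
move=> /subsetP Qs; apply/subsetP => t tQ; rewrite gen_eq; apply/perpP.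
by split=> [|f /perpP[_ h]]; [exact: Qs|rewrite homC; apply: h].
Qed.

Lemma hom_refl c w : w != [::] -> has_hom c w w.
Proof. by move=> w0; apply/homP; exists w; apply: occ_refl. Qed.

Lemma gen_torsion c Q : Q \subset segs -> torsion_pair (gen c Q).
Proof.
(* Either way a half is an orthogonal set, so [perp_closed] gives closure of both halves at once. *)
move=> Qs; have e b : gen c Q b = perp (~~ b) (gen c Q (~~ b)) \/
    b = ~~ c /\ gen c Q b = perp c Q.
  have [->|/negb_neq->] := eqVneq b c; first by left; rewrite gen_eq gen_neq.
  by right; rewrite gen_neq.
have gs b : gen c Q b \subset segs.
  by case: (e b) => [->|[_ ->]]; exact: perp_segs.
have gcl b u w : words (gen c Q b) w -> occ b u w -> words (gen c Q b) u.
  move=> /wordsP[t tg <-] o.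
  have /segment_word[u' eu] : is_segment u.
    by apply: occ_segment o; have := subsetP (gs b) _ tg; rewrite inE.
  rewrite -eu words_pts in o *.
  case: (e b) tg => [->|[eb ->]] tg; apply: perp_closed tg _; rewrite ?negbK //.
  by rewrite -eb.
have gdisj w : words (gen c Q c) w -> words (gen c Q (~~ c)) w -> False.
  rewrite gen_eq gen_neq => /wordsP[t /perpP[ts h] <-]; rewrite words_pts => tp.
  have := h t tp; rewrite hom_refl //.
  by apply: (@segment_nil lambda); rewrite inE in ts.
split.
- by move=> b w; rewrite -words_segs; apply: words_sub.
- exact: gcl.
- move=> b w; have [->|/negb_neq->] := eqVneq b c; first exact: gdisj.
  by rewrite negbK => h1 h2; apply: gdisj h2 h1.
- move=> b w' sw; have [w ew] := segment_word sw; subst w'; rewrite words_pts => nw.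
  have ws : w \in segs by rewrite inE.
  move: nw; have [->|/negb_neq->] := eqVneq b c.
    rewrite gen_eq inE ws /= => /forall_inPn[f fp]; rewrite negbK homC.
    move=> /homP[u o1 o2]; exists u => //; apply: gcl o2.
    by rewrite gen_neq words_pts.
  rewrite gen_neq negbK inE ws /= => /forall_inPn[t tQ]; rewrite negbK.
  move=> /homP[u o1 o2]; exists u => //; apply: gcl o1.
  by rewrite words_pts (subsetP (sub_gen c Qs)).
Qed.

Section Pairs.
Variables (X Y : bool -> {set word lambda}).
Hypotheses (tX : torsion_pair X) (tY : torsion_pair Y).

Lemma pair_segment c s : s \in X c -> is_segment (pts s).
Proof. by rewrite -words_pts; apply: (torsion_segment tX). Qed.

Lemma pair_sub_segs c : X c \subset segs.
Proof. by apply/subsetP => s /pair_segment; rewrite inE. Qed.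

Lemma pair_closed c u s : s \in X c -> occ c u (pts s) -> exists2 u', u' \in X c & pts u' = u.
Proof.
by rewrite -words_pts => xs o; apply/wordsP; apply: (torsion_closed tX xs o).
Qed.

Lemma pair_disjoint c s : s \in X c -> s \in X (~~ c) -> False.
Proof. by rewrite -!words_pts; apply: (torsion_disjoint tX). Qed.

Lemma pair_witness c s : s \in segs -> s \notin X c ->
  exists2 u, occ c (pts u) (pts s) & u \in X (~~ c).
Proof.
rewrite inE -words_pts => ss nx.
have [u o /wordsP[u' xu e]] := torsion_witness tX ss nx.
by exists u'; rewrite ?e.
Qed.

Lemma pair_hom c t f : t \in X c -> f \in X (~~ c) -> ~~ has_hom c (pts t) (pts f).
Proof.
move=> xt xf; apply/homP => -[u o1 o2].
have [u1 xu1 e1] := pair_closed xt o1; have [u2 xu2 e2] := pair_closed xf o2.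
by apply: (pair_disjoint xu1); have -> : u1 = u2 by apply: pts_inj; rewrite e1.
Qed.

Lemma pair_perp c t : t \in segs ->
  {in X (~~ c), forall f, ~~ has_hom c (pts t) (pts f)} -> t \in X c.
Proof.
move=> ts h; apply/negPn/negP => nx; have [u o xu] := pair_witness ts nx.
have /homP[] := h u xu; exists (pts u) => //.
by apply/occ_refl/(occ_nil o).
Qed.

Lemma pair_anti c : X c \subset Y c -> Y (~~ c) \subset X (~~ c).
Proof.
move=> /subsetP XY; apply/subsetP => f fY; apply: contraT => nx.
have fs : f \in segs.
  by have := torsion_segment tY (_ : words (Y (~~ c)) (pts f)); rewrite words_pts inE; apply.
have [u o] := pair_witness fs nx; rewrite negbK => /XY; rewrite -words_pts => uY.
rewrite -words_pts in fY.
by have [] := torsion_disjoint tY uY; apply: (torsion_closed tY fY o).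
Qed.

End Pairs.

Lemma gen_min c Q Y : torsion_pair Y -> Q \subset Y c -> gen c Q c \subset Y c.
Proof.
move=> tY QY; apply/subsetP => t; rewrite gen_eq => /perpP[ts h].
apply: (pair_perp tY) => // f fY.
rewrite -homC; apply: h; apply/perpP; split; first exact: subsetP (pair_sub_segs tY _) _ fY.
by move=> t' /(subsetP QY) t'Y; apply: (pair_hom tY).
Qed.

Lemma torsion_pair_eq X Y c : torsion_pair X -> torsion_pair Y -> X c = Y c -> X =1 Y.
Proof.
move=> tX tY e b; have [->//|/negb_neq->] := eqVneq b c.
apply/eqP; rewrite eqEsubset (pair_anti tY tX) ?e //=.
by apply: pair_anti; rewrite ?e.
Qed.

Lemma torsion_pair_eq_sub X Y : torsion_pair X -> torsion_pair Y ->
  (forall c, X c \subset Y c) -> X =1 Y.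
Proof.
move=> tX tY h; apply: (torsion_pair_eq (c := true)) => //; apply/eqP; rewrite eqEsubset h.
by have := pair_anti tX tY (h false).
Qed.

(** Take the pair whose other half is generated by the union of the other halves: being orthogonal
    to a union is being orthogonal to both sets. *)
Lemma pair_meet c X Y : torsion_pair X -> torsion_pair Y -> exists2 Z,
  torsion_pair Z & Z c = X c :&: Y c.
Proof.
move=> tX tY.
have Qs : X (~~ c) :|: Y (~~ c) \subset segs.
  by rewrite subUset !pair_sub_segs.
exists (gen (~~ c) (X (~~ c) :|: Y (~~ c))); first exact: gen_torsion.
have := gen_neq (~~ c) (X (~~ c) :|: Y (~~ c)); rewrite negbK => ->.
apply/setP => t; rewrite in_setI.
apply/perpP/andP => [[ts h]|[tX' tY']].
  split; apply: pair_perp => // f fX; rewrite -homC; apply: h;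
  by rewrite inE fX ?orbT.
split; first by apply: subsetP (pair_sub_segs tX c) _ _.
by move=> f; rewrite homC inE => /orP[]; apply: pair_hom.
Qed.

Definition labels c (X : bool -> {set word lambda}) : {set word lambda} :=
  [set s in X c | minimal (fun b => words (X b)) c (pts s) &&
    [forall t in X c, minimal (fun b => words (X b)) c (pts t) ==>
       occ c (pts s) (pts t) ==> (t == s)]].

Lemma labelsP c X s : reflect (is_label (fun b => words (X b)) c (pts s)) (s \in labels c X).
Proof.
rewrite inE; apply: (iffP and3P) => [[xs ms /forall_inP h]|[ms h]].
  split=> // t /[dup] /minimalP[/wordsP[t' xt <-] _] mt o.
  by have := h t' xt; rewrite mt o /= => /eqP->.
split=> //; first by have /minimalP[] := ms; rewrite words_pts.
apply/forall_inP => t xt; apply/implyP => mt; apply/implyP => o.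
by apply/eqP/pts_inj/h.
Qed.

Lemma labels_sub c X s : s \in labels c X -> s \in X c.
Proof. by case/setIdP. Qed.

(* Among the elements of [X c] in [Y (~~ c)], a shortest one is minimal, and a
   longest minimal one is a label. *)
Lemma label_exists c X Y : torsion_pair X -> torsion_pair Y ->
  Y c \subset X c -> ~~ (X c \subset Y c) -> exists2 s, s \in labels c X & s \in Y (~~ c).
Proof.
move=> tX tY /subsetP YX /subsetPn[w xw yw].
have [u o yu] := pair_witness tY (subsetP (pair_sub_segs tX c) _ xw) yw.
have xu : u \in X c by have [u' xu' /pts_inj <-] := pair_closed tX xw o.
have [v ov mv] : exists2 v, occ (~~ c) v (pts u) & minimal (fun b => words (X b)) c v.
  by apply: (minimal_exists tX); rewrite words_pts.
have [v1 yv ev] := pair_closed tY yu ov.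
pose P v := (v \in Y (~~ c)) && minimal (fun b => words (X b)) c (pts v).
have Pv : P v1 by rewrite /P yv ev.
case: (arg_maxnP (fun v => size (pts v)) Pv) => s /andP[ys ms] mx.
exists s => //; apply/labelsP; split=> // t mt st.
have /minimalP[/wordsP[t' xt' et] mt'] := mt.
(* Otherwise some [~~ c]-slice [r] of [t'] is in [Y c], hence in [X c], and minimality makes it all
   of [t']. Then [s], a [c]-slice of it, would be in both halves of [Y]. *)
have yt : t' \in Y (~~ c).
  apply/negPn/negP => nyt.
  have [r rt] := pair_witness tY (subsetP (pair_sub_segs tX c) _ xt') nyt.
  rewrite negbK => yr; have er : pts r = t.
    by apply: mt'; rewrite -?et // words_pts YX.
  rewrite -er in st; have [s' ys' /pts_inj e] := pair_closed tY yr st.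
  by apply: (pair_disjoint tY ys'); rewrite e.
have := mx t'; rewrite /P yt et => /(_ mt) sz.
by apply/esym/(occ_size_eq st).
Qed.

End Words.

(** * Kissing, friendliness and straightness in terms of slices and turns *)

Lemma slice_infix w i j : infix (slice w i j) w.
Proof.
apply/infixP; exists (take i (take j w)), (drop j w).
by rewrite catA cat_take_drop cat_take_drop.
Qed.

Lemma enters_fromP c t w : sorted se_step w -> t != [::] -> reflect
  (exists i j, [/\ 0 < i, i < j, j <= size w, turn w i = c & t = slice w i j])
  (enters_from (bwd c) t w).
Proof.
case: t => // v t sw _; apply: (iffP idP) => [/infixP[l [r ew]]|].
  have e1 : turn w (size l + 1) = c.
    by rewrite ew turn_catm // -[v]/(head origin (v :: t)) turn_cons1.
  have e2 : slice w (size l + 1) (size l + (size t).+2) = v :: t.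
    by rewrite ew slice_catm // /slice /= take_size.
  exists (size l + 1), (size l + (size t).+2); rewrite e2; split=> //; try arith.
  by rewrite ew !size_cat leq_add2l leq_addr.
move=> [i [j [i0 ij jw ti e]]].
have ei : nth origin w i = v by have := congr1 (head origin) e; rewrite (slice_cons ij jw) /= => ->.
have := slice_infix w i.-1 j.
rewrite slice_cons ?prednK //; last by arith.
by rewrite -e (nth_bwd sw) ?ei ?ti //; arith.
Qed.

Lemma leaves_toP c t w : sorted se_step w -> t != [::] -> reflect
  (exists i j, [/\ i < j, j < size w, turn w j = c & t = slice w i j])
  (leaves_to (fwd c) t w).
Proof.
case: t => // v t sw _; apply: (iffP idP) => [|[i [j [ij jw tj e]]]].
  rewrite /leaves_to -[last v t]/(last origin (v :: t)) => /infixP[l [r ew]].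
  have e1 : turn w (size l + (size t).+1) = c.
    by rewrite ew turn_catm ?size_rcons //= -[(size t).+1]/(size (v :: t)) -rcons_cons turn_rcons_last.
  have e2 : slice w (size l + 0) (size l + (size t).+1) = v :: t.
    by rewrite ew slice_catm ?size_rcons //= /slice drop0 -rcons_cons -cats1 take_size_cat.
  rewrite addn0 in e2; exists (size l), (size l + (size t).+1); rewrite e2; split=> //; try arith.
  by rewrite ew !size_cat size_rcons ltn_add2l ltnS leq_addr.
have ei : nth origin w j.-1 = last v t.
  have := congr1 (fun s => nth origin s (j.-1 - i)) e.
  rewrite nth_slice ?subnKC; [|arith..].
  have -> : j.-1 - i = (size (v :: t)).-1 by rewrite e size_slice ?(ltnW jw) //; arith.
  by rewrite nth_last => <-.
have := slice_infix w i j.+1.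
rewrite slice_rcons ?(ltnW ij) // (nth_fwd (k := j) sw) //; last by arith.
by rewrite ei tj -e.
Qed.

Lemma prefix_sliceP (u w : seq point) :
  reflect (exists2 j, j <= size w & u = slice w 0 j) (prefix u w).
Proof.
rewrite prefixE; apply: (iffP eqP) => [e|[j jw ->]]; last first.
  by rewrite /slice drop0 size_takel.
exists (size u); last by rewrite /slice drop0.
by rewrite -e size_take_min geq_minr.
Qed.

Lemma suffix_sliceP (u w : seq point) :
  reflect (exists2 i, i <= size w & u = slice w i (size w)) (suffix u w).
Proof.
rewrite suffixE; apply: (iffP eqP) => [e|[i iw ->]]; last first.
  by rewrite /slice take_size size_drop subKn.
by exists (size w - size u); [exact: leq_subr|rewrite /slice take_size].
Qed.

Lemma mem_soccs c t w : sorted se_step w -> t != [::] ->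
  (t \in soccs c w) = enters_from (bwd c) t w && leaves_to (fwd (~~ c)) t w.
Proof.
move=> sw t0; have uw := sorted_step_uniq sw; apply/soccP/andP.
  move=> [i [j [/and5P[i0 ij jw /eqP ti /eqP tj] e]]]; split.
    by apply/enters_fromP => //; exists i, j; rewrite (ltnW jw).
  by apply/leaves_toP => //; exists i, j.
move=> [/(enters_fromP _ sw t0)[i [j [i0 ij jw ti e]]]].
move=> /(leaves_toP _ sw t0)[i' [j' [ij' jw' tj' e']]].
have [ei ej] : i = i' /\ j = j' by apply: (slice_inj uw) => //; rewrite -?e // ltnW.
by subst i' j'; exists i, j; rewrite /strict i0 ij jw' ti tj' !eqxx.
Qed.

(** The condition on the left end and the one on the right end each give an occurrence of [u]; these
    agree because the points of [w] are distinct. *)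
Lemma occE c u w : sorted se_step w -> u != [::] ->
  occ c u w = (prefix u w || enters_from (bwd c) u w) &&
    (suffix u w || leaves_to (fwd (~~ c)) u w).
Proof.
move=> sw u0; have uw := sorted_step_uniq sw; apply/occP/andP.
  move=> [i [j [/and5P[_ ij jw ci cj] e]]]; split.
    have [i0|i0] := posnP i; first by apply/orP; left; apply/prefix_sliceP; exists j; rewrite -?i0.
    apply/orP; right; apply/enters_fromP => //; exists i, j; split=> //.
    by apply: cut_neq ci _; rewrite -lt0n.
  have [ej|nj] := eqVneq j (size w).
    by apply/orP; left; apply/suffix_sliceP; exists i; rewrite -?ej // ltnW.
  apply/orP; right; apply/leaves_toP => //; exists i, j; split=> //.
    by rewrite ltn_neqAle nj.
  exact: cut_neq cj nj.
move=> [hl hr].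
have [i [j [ij jw ci e]]] : exists i j, [/\ i < j, j <= size w, cut (turn w) c 0 i & u = slice w i j].
  case/orP: hl => [/prefix_sliceP[j jw e]|/(enters_fromP _ sw u0)[i [j [i0 ij jw ti e]]]].
    exists 0, j; split=> //; by have := u0; rewrite e -size_eq0 size_slice //; arith.
  by exists i, j; split=> //; apply: cut_eq.
have [i' [j' [ij' jw' cj e']]] : exists i j,
    [/\ i < j, j <= size w, cut (turn w) (~~ c) (size w) j & u = slice w i j].
  case/orP: hr => [/suffix_sliceP[i' iw' e']|/(leaves_toP _ sw u0)[i' [j' [ij' jw' tj' e']]]].
    exists i', (size w); split=> //; last exact: cutxx.
    by have := u0; rewrite e' -size_eq0 size_slice //; arith.
  by exists i', j'; split=> //; [exact: ltnW|exact: cut_eq].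
have [ei ej] : i = i' /\ j = j' by apply: (slice_inj uw) => //; rewrite -?e.
by subst i' j'; exists i, j; rewrite /subslice leq0n ij jw ci cj.
Qed.

Lemma kiss_alongE s p q : sorted se_step p -> sorted se_step q -> s != [::] ->
  kiss_along s p q = (s \in soccs true p) && (s \in soccs false q).
Proof. by move=> sp sq s0; rewrite !mem_soccs // -andbA. Qed.

Lemma friendly_alongE u s t : sorted se_step s -> sorted se_step t -> u != [::] ->
  friendly_along u s t = occ true u s && occ false u t.
Proof. by move=> ss st u0; rewrite !occE // -andbA. Qed.

Definition turns c w := has (fun k => turn w k == c) (iota 1 (size w).-1).

Lemma turnsP c w : reflect (exists k, [/\ 0 < k, k < size w & turn w k = c]) (turns c w).
Proof.
apply: (iffP hasP) => [[k]|[k [k0 kw tk]]].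
  by rewrite mem_iota => kw /eqP tk; exists k; split=> //; arith.
by exists k; rewrite ?tk // mem_iota; arith.
Qed.

Lemma horizontalE w : horizontal w = ~~ turns false w.
Proof.
apply/(sortedP origin)/idP => [h|/turnsP h i iw].
  apply/turnsP => -[[|k] []] // _ kw; rewrite /turn /=.
  by have /= -> := h _ kw.
by apply: contraT => ne; case: h; exists i.+1; rewrite /turn /= (negbTE ne).
Qed.

Lemma verticalE w : sorted se_step w -> vertical w = ~~ turns true w.
Proof.
move=> sw; apply/(sortedP origin)/idP => [h|/turnsP h i iw].
  apply/turnsP => -[[|k] []] // _ kw.
  have /= /eqP := h _ kw; rewrite /turn /= => ->.
  by rewrite -[south _]/(fwd false _) fwd_east.
rewrite (nth_fwd sw) //=; case e: (turn _ _); last by rewrite /= eqxx.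
by case: h; exists i.+1.
Qed.

(** * Facets *)

(** A bijection can then be counted by using one relation in both directions, without naming a
    function either way. *)
Lemma leq_card_rel (T U : finType) (A : {set T}) (B : {set U}) (R : T -> U -> Prop) :
  (forall a, a \in A -> exists2 b, b \in B & R a b) ->
  (forall a a' b, a \in A -> a' \in A -> R a b -> R a' b -> a = a') ->
  #|A| <= #|B|.
Proof.
move=> ex inj.
have /fin_all_exists[f fP] : forall a : {a | a \in A}, exists b, b \in B /\ R (val a) b.
  by move=> [a aA]; have [b bB r] := ex a aA; exists b.
rewrite -[#|A|]card_sig -(card_imset (f := f)); last first.
  move=> a a' e; apply: val_inj; have [_ r] := fP a; have [_ r'] := fP a'.
  by rewrite e in r; apply: inj r r'; apply: valP.
by apply/subset_leq_card/subsetP => _ /imsetP[a _ ->]; have [] := fP a.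
Qed.

Section Facets.
Variable lambda : grid_shape.
Implicit Types (p q s t f : word lambda) (Q A B F : {set word lambda}).
Implicit Types X Y : bool -> {set word lambda}.
Local Notation is_path := (is_path lambda).
Local Notation is_segment := (is_segment lambda).
Local Notation NK := (reduced_nonkissing_complex lambda).
Local Notation wds X := (fun c => words (X c)).

Definition bent : {set word lambda} :=
  [set p | [&& is_path (pts p), ~~ horizontal (pts p) & ~~ vertical (pts p)]].

Lemma is_path_sorted p : is_path (pts p) -> sorted se_step (pts p).
Proof. by move/path_trail/trail_sorted. Qed.

Lemma is_path_uniq p : is_path (pts p) -> uniq (pts p).
Proof. by move/path_trail/trail_uniq. Qed.

Lemma bentP p : reflect (is_path (pts p) /\ forall c, turns c (pts p)) (p \in bent).
Proof.
rewrite inE; apply: (iffP and3P) => [[pp nh nv]|[pp h]].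
  split=> // -[]; first by move: nv; rewrite verticalE ?negbK // is_path_sorted.
  by move: nh; rewrite horizontalE negbK.
by split=> //; rewrite ?horizontalE ?verticalE ?is_path_sorted // negbK.
Qed.

Lemma strict_bent p c i j : is_path (pts p) -> strict c (pts p) i j -> p \in bent.
Proof.
move=> pp /and5P[i0 ij jp /eqP ti /eqP tj]; apply/bentP; split=> // b.
have [->|/negb_neq->] := eqVneq b c; apply/turnsP; first by exists i; rewrite (ltn_trans ij).
by exists j; rewrite (ltn_trans i0).
Qed.

Lemma socc_segment c u w : is_path w -> u \in soccs c w -> is_segment u.
Proof.
move=> /path_trail tw /soccP[i [j [/and5P[i0 ij jw _ _] ->]]].
exact: trail_segment.
Qed.

Lemma kissingP p q : is_path (pts p) -> is_path (pts q) -> reflect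
  (exists c u, u \in soccs c (pts p) /\ u \in soccs (~~ c) (pts q)) (kissing p q).
Proof.
move=> pp pq; have sp := is_path_sorted pp; have sq := is_path_sorted pq.
apply: (iffP existsP) => [[s /andP[/segment_nil s0]]|[c [u [up uq]]]].
  rewrite !kiss_alongE // => /orP[]/andP[h1 h2]; first by exists true, (pts s).
  by exists false, (pts s).
have su := socc_segment pp up; have [s es] := segment_word su.
exists s; rewrite es su /= !kiss_alongE ?(segment_nil su) //.
by case: c up uq => -> -> //; rewrite orbT.
Qed.

Lemma socc_both c u w : uniq w -> u \in soccs c w -> u \in soccs (~~ c) w -> False.
Proof.
move=> uw /soccP[i [j [/and5P[i0 ij jw /eqP ti _] ->]]].
move=> /soccP[i' [j' [/and5P[i0' ij' jw' /eqP ti' _] e]]].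
have [ei _] := slice_inj uw ij (ltnW jw) ij' (ltnW jw') e.
by move: ti'; rewrite -ei ti; case: (c).
Qed.

(** The case [p = q] is harmless: a path does not kiss itself, by [socc_both]. *)
Lemma NK_P A : reflect
  (A \subset bent /\ forall c u p q, p \in A -> q \in A ->
     u \in soccs c (pts p) -> u \in soccs (~~ c) (pts q) -> False)
  (A \in NK).
Proof.
rewrite inE -/bent; apply: (iffP andP) => -[Ab h]; split=> //.
  move=> c u p q pA qA up uq.
  have /bentP[pp _] := subsetP Ab _ pA; have /bentP[pq _] := subsetP Ab _ qA.
  have [epq|npq] := eqVneq p q; first by subst q; apply: socc_both up uq; apply: is_path_uniq.
  move/forall_inP/(_ p pA)/forall_inP/(_ q qA): h; rewrite npq /= => /negP; apply.
  by apply/kissingP => //; exists c, u.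
apply/forall_inP => p pA; apply/forall_inP => q qA; apply/implyP => npq.
have /bentP[pp _] := subsetP Ab _ pA; have /bentP[pq _] := subsetP Ab _ qA.
by apply/kissingP => // -[c [u [up uq]]]; apply: h up uq.
Qed.

Definition facet_of X : {set word lambda} := [set p in bent | good (wds X) (pts p)].

Lemma facet_ofP X p : reflect (p \in bent /\ good (wds X) (pts p)) (p \in facet_of X).
Proof. exact: setIdP. Qed.

Lemma eq_facet_of X Y : X =1 Y -> facet_of X = facet_of Y.
Proof. by move=> e; apply/setP => p; rewrite !inE /good !e. Qed.

Lemma facet_of_NK X : torsion_pair X -> facet_of X \in NK.
Proof.
move=> tX; apply/NK_P; split; first by apply/subsetP => p /facet_ofP[].
move=> c u p q /facet_ofP[_ /goodP gp] /facet_ofP[_ /goodP gq] /gp up /gq uq.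
exact: (torsion_disjoint tX up uq).
Qed.

Definition strict_slices c A : {set word lambda} :=
  [set t | [exists p in A, pts t \in soccs c (pts p)]].

Lemma strict_slicesP c A t : reflect (exists2 p, p \in A & pts t \in soccs c (pts p))
  (t \in strict_slices c A).
Proof. by rewrite inE; apply: exists_inP. Qed.

Lemma strict_slices_segs c A : A \subset bent -> strict_slices c A \subset segs lambda.
Proof.
move=> /subsetP Ab; apply/subsetP => t /strict_slicesP[p /Ab/bentP[pp _] o].
by rewrite inE; apply: socc_segment o.
Qed.

(** The strict [c]-slices of [A] are generators. A strict [~~ c]-slice is orthogonal to them, since
    a common piece would be one along which two paths of [A] kiss. *)
Lemma sub_facet_of c A : A \in NK -> A \subset facet_of (gen c (strict_slices c A)).
Proof.
move=> /NK_P[Ab nk]; have Qs := strict_slices_segs c Ab.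
apply/subsetP => p pA; apply/facet_ofP; split; first exact: subsetP Ab _ pA.
have /bentP[pp _] := subsetP Ab _ pA.
apply/goodP => b u ou; have su := socc_segment pp ou.
have [t et] := segment_word su; rewrite -et words_pts; rewrite -et in ou su.
have [eb|/negb_neq eb] := eqVneq b c; rewrite eb in ou *.
  by apply: subsetP (sub_gen c Qs) _ _; apply/strict_slicesP; exists p.
rewrite gen_neq; apply/perpP; split=> [|t' /strict_slicesP[q qA oq]]; first by rewrite inE.
apply/homP => -[v o1 o2]; apply: (nk c v q p qA pA); first exact: socc_trans oq.
exact: socc_trans ou.
Qed.

Lemma gen_strict_slices_min c A Y : torsion_pair Y -> A \subset facet_of Y ->
  gen c (strict_slices c A) c \subset Y c.
Proof.
move=> tY /subsetP AY; apply: gen_min => //; apply/subsetP => t.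
move=> /strict_slicesP[p /AY/facet_ofP[_ /goodP g] /g].
by rewrite words_pts.
Qed.

(** An element of [X c] outside [Y c] contains a minimal word of [X c] lying in [Y (~~ c)]. The path
    through it given by [minimal_path] is in the first facet but not in the second. *)
Lemma facet_of_mono X Y : torsion_pair X -> torsion_pair Y ->
  facet_of X \subset facet_of Y -> X =1 Y.
Proof.
move=> tX tY /subsetP XY; apply: torsion_pair_eq_sub => // c.
apply/subsetP => w xw; apply/negPn/negP => yw.
have [u o yu] := pair_witness tY (subsetP (pair_sub_segs tX c) _ xw) yw.
have xu : u \in X c by have [u' xu' /pts_inj <-] := pair_closed tX xw o.
have [v ov mv] : exists2 v, occ (~~ c) v (pts u) & minimal (wds X) c v.
  by apply: (minimal_exists tX); rewrite words_pts.
have [p [k [k' [pp gp sp ev dk]]]] := minimal_path tX mv.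
have [p' ep] := path_word pp; subst p.
have : p' \in facet_of Y by apply: XY; apply/facet_ofP; rewrite (strict_bent pp sp).
move=> /facet_ofP[_ gp'].
have [v1 yv1 ev1] := pair_closed tY yu ov.
have := good_strict gp' sp; rewrite -ev -ev1 words_pts => yv.
exact: (pair_disjoint tY yv yv1).
Qed.

Lemma facetsP F : reflect (exists2 X, torsion_pair X & F = facet_of X) (F \in facets NK).
Proof.
rewrite inE; apply: (iffP maxsetP) => [[FK mx]|[X tX ->]].
  have Fb : F \subset bent by have /NK_P[] := FK.
  exists (gen true (strict_slices true F)).
    exact/gen_torsion/strict_slices_segs.
  apply/esym/mx; last exact: sub_facet_of.
  exact/facet_of_NK/gen_torsion/strict_slices_segs.
split=> [|B BK XB]; first exact: facet_of_NK.
have Bb : B \subset bent by have /NK_P[] := BK.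
have BY := sub_facet_of true BK.
have tY := gen_torsion true (strict_slices_segs true Bb).
have e := facet_of_mono tX tY (subset_trans XB BY).
by apply/eqP; rewrite eqEsubset XB andbT (eq_facet_of e).
Qed.

Lemma NK_sub_facet A : A \in NK -> exists2 X, torsion_pair X & A \subset facet_of X.
Proof.
move=> AK; exists (gen true (strict_slices true A)); last exact: sub_facet_of.
by apply/gen_torsion/strict_slices_segs; have /NK_P[] := AK.
Qed.

Definition horizontals : {set word lambda} :=
  [set p | is_path (pts p) && horizontal (pts p)].

(* Non-vertical paths of the unreduced facet correspond to the horizontal edges
   at which they are distinguished, and horizontal paths lie in every facet. *)
Lemma card_facet_of X : torsion_pair X ->
  #|facet_of X| + #|horizontals| = #|[set v : lambda | east (val v) \in lambda]|.
Proof.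
move=> tX; pose N := [set p : word lambda | [&& is_path (pts p), turns true (pts p) & good (wds X) (pts p)]].
have -> : #|facet_of X| + #|horizontals| = #|N|.
  rewrite -(cardsID horizontals N) addnC; congr (_ + _).
    apply: eq_card => p; rewrite !inE horizontalE.
    have [pp|_] := boolP (is_path (pts p)) => //=.
    (* A horizontal path has at least two points, hence an East step, and it is good because it has
       no strict slices. *)
    have [tf|ntf] := boolP (turns false (pts p)); rewrite ?andbF // andbT; symmetry; apply/andP; split.
      have /is_pathP[_ p1 _ _] := pp; apply/turnsP; exists 1; split=> //.
      have [//|/negb_neq t1] := eqVneq (turn (pts p) 1) true.
      by case/turnsP: ntf; exists 1.
    apply/goodP => c u /soccP[i [j [/and5P[i0 ij jp /eqP ti /eqP tj] _]]].
    case/turnsP: ntf; case: c ti tj => ti tj; first by exists j; rewrite (ltn_trans i0).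
    by exists i; rewrite (ltn_trans ij).
  apply: eq_card => p; rewrite !inE horizontalE.
  have [pp|_] := boolP (is_path (pts p)); last by rewrite !andbF.
  rewrite verticalE ?is_path_sorted // !negbK.
  by case: (turns false _); case: (turns true _).
pose R (p : word lambda) (v : lambda) := [/\ is_path (pts p), good (wds X) (pts p) & exists k,
  [/\ distinguished (size (pts p)) (turn (pts p)) (on_slices (wds X) (pts p)) k,
      turn (pts p) k = true & nth origin (pts p) k.-1 = val v]].
apply/eqP; rewrite eqn_leq; apply/andP; split.
  apply: (leq_card_rel (R := R)) => [p|p p' v].
    rewrite inE => /and3P[pp /turnsP[k0 [k00 k0p t0]] gp].
    have tp := path_trail pp; have k0r : 0 < k0 < size (pts p) by rewrite k00.
    have [k [dk tk]] := distinguished_exists (slices_closed tX tp)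
      (@slices_disjoint _ _ tX _) (slices_witness tX tp) k0r t0.
    have [/andP[k10 kp] _ _] := dk.
    have vl : nth origin (pts p) k.-1 \in lambda.
      by apply: (trail_sub tp); apply/mem_nth/(leq_ltn_trans (leq_pred k) kp).
    exists (FSetSub vl); last by split=> //; exists k.
    have e := nth_fwd (trail_sorted tp) k10 kp; rewrite tk in e.
    rewrite inE -[east _]/(fwd true (nth origin (pts p) k.-1)) -e.
    by apply: (trail_sub tp); apply: mem_nth.
  move=> _ _ [pp gp [k [dk tk ek]]] [pp' gp' [l [dl tl el]]].
  by apply: pts_inj; apply: (same_edge_path pp pp' gp gp' dk dl); rewrite ?tk ?ek.
apply: (leq_card_rel (R := fun v p => R p v)) => [v|v v' p _ _].
  rewrite inE => ev; have [w [k [pw gw dk ek ek']]] := edge_path tX (b := true) (valP v) ev.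
  have [p ep] := path_word pw; subst w.
  have [/andP[k0 kp] _ _] := dk.
  have tk : turn (pts p) k = true by rewrite /turn ek ek' /= eqxx.
  exists p; last by split=> //; exists k.
  by rewrite inE pw gw andbT; apply/turnsP; exists k.
move=> [pp gp [k [dk tk ek]]] [_ _ [l [dl tl el]]]; apply: val_inj.
rewrite -ek -el; congr (nth _ _ _.-1); have tp := path_trail pp.
apply: (distinguished_inj (@slices_disjoint _ _ tX (pts p)) (slices_witness tX tp)
  (good_compatible gp) dk dl).
by rewrite tk tl.
Qed.

End Facets.

(** * Flips *)

Section Flips.
Variable lambda : grid_shape.
Implicit Types (p q s t f : word lambda) (Q A B F : {set word lambda}).
Implicit Types X Y Z : bool -> {set word lambda}.
Local Notation is_path := (is_path lambda).
Local Notation NK := (reduced_nonkissing_complex lambda).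
Local Notation wds X := (fun c => words (X c)).
Local Notation dist X p k :=
  (distinguished (size (pts p)) (turn (pts p)) (on_slices (wds X) (pts p)) k).

Definition label_paths c X : {set word lambda} :=
  [set p in facet_of X | [exists s in labels c X, pts s \in soccs c (pts p)]].

Lemma label_pathsP c X p : reflect
  (p \in facet_of X /\ exists2 s, s \in labels c X & pts s \in soccs c (pts p))
  (p \in label_paths c X).
Proof.
apply: (iffP setIdP) => -[pF h]; split=> //; first by have /exists_inP := h.
exact/exists_inP.
Qed.

Section OnePair.
Variable X : bool -> {set word lambda}.
Hypothesis tX : torsion_pair X.

Lemma label_junctions c p s : p \in facet_of X -> s \in labels c X ->
  pts s \in soccs c (pts p) -> exists k k',
  [/\ dist X p k, dist X p k', turn (pts p) k = c, turn (pts p) k' = ~~ c & k < k'] /\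
  pts s = slice (pts p) k k'.
Proof.
move=> /facet_ofP[/bentP[pp _] gp] /labelsP ls /soccP[k [k' [sk es]]].
rewrite es in ls; have [dk dk'] := strict_label_distinguished tX pp gp ls sk.
by have /and5P[_ kk' _ /eqP tk /eqP tk'] := sk; exists k, k'.
Qed.

Lemma label_path_exists c s : s \in labels c X ->
  exists2 p, p \in facet_of X & pts s \in soccs c (pts p).
Proof.
move=> /labelsP /(label_path tX)[w [k [k' [[pw gw dk dk'] [tk tk' kk' es]]]]].
have [p ep] := path_word pw; subst w.
have [/andP[k0 _] _ _] := dk; have [/andP[_ kp] _ _] := dk'.
have sk : strict c (pts p) k k' by rewrite /strict k0 kk' kp tk tk' !eqxx.
exists p; first by apply/facet_ofP; rewrite (strict_bent pw sk).
by apply/soccP; exists k, k'.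
Qed.

Lemma label_path_unique c s p q : s \in labels c X ->
  p \in facet_of X -> q \in facet_of X ->
  pts s \in soccs c (pts p) -> pts s \in soccs c (pts q) -> p = q.
Proof.
move=> ls pF qF sp /soccP[l [l' [sl esl]]].
have [k [k' [[dk dk' tk tk' kk'] es]]] := label_junctions pF ls sp.
have /facet_ofP[/bentP[pp _] gp] := pF; have /facet_ofP[/bentP[pq _] gq] := qF.
apply: pts_inj; apply: (same_slice_path pp pq gp gq dk dk' _ kk' (l := l) (l' := l')).
- by rewrite tk tk'.
- by rewrite tk.
- by rewrite -es -esl.
Qed.

Lemma facet_dist_inj p k l : p \in facet_of X -> dist X p k -> dist X p l ->
  turn (pts p) k = turn (pts p) l -> k = l.
Proof.
move=> /facet_ofP[/bentP[/path_trail tp _] gp].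
exact: (distinguished_inj (@slices_disjoint _ _ tX _) (slices_witness tX tp)
  (good_compatible gp)).
Qed.

Lemma card_label_paths c : #|label_paths c X| = #|labels c X|.
Proof.
pose R p s := [/\ p \in facet_of X, s \in labels c X & pts s \in soccs c (pts p)].
apply/eqP; rewrite eqn_leq; apply/andP; split.
  apply: (leq_card_rel (R := R)) => [p /label_pathsP[pF [s ls sp]]|p q s _ _].
    by exists s.
  by move=> [pF ls sp] [qF _ sq]; apply: label_path_unique sp sq.
apply: (leq_card_rel (R := fun s p => R p s)) => [s ls|s t p _ _].
  have [p pF sp] := label_path_exists ls.
  by exists p => //; apply/label_pathsP; split=> //; exists s.
move=> [pF ls sp] [_ lt tp]; apply: pts_inj.
have [k [k' [[dk dk' tk tk' kk'] ->]]] := label_junctions pF ls sp.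
have [l [l' [[dl dl' tl tl' ll'] ->]]] := label_junctions pF lt tp.
have e1 : k = l by apply: (facet_dist_inj pF dk dl); rewrite tk.
have e2 : k' = l' by apply: (facet_dist_inj pF dk' dl'); rewrite tk'.
by rewrite e1 e2.
Qed.

(** A bent path has a distinguished junction in each direction, and the slice between the two is a
    label of the side given by the direction of the first. *)
Lemma label_pathsU : facet_of X = label_paths true X :|: label_paths false X.
Proof.
apply/setP => p; rewrite in_setU; apply/idP/orP => [pF|[]/label_pathsP[]//].
have /facet_ofP[/bentP[pp tb] gp] := pF; have tp := path_trail pp.
have ex b : exists k, dist X p k /\ turn (pts p) k = b.
  have /turnsP[k0 [k00 k0p t0]] := tb b.
  have k0r : 0 < k0 < size (pts p) by rewrite k00.
  exact: (distinguished_exists (slices_closed tX tp)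
    (@slices_disjoint _ _ tX _) (slices_witness tX tp) k0r t0).
have side c k k' : dist X p k -> dist X p k' -> turn (pts p) k = c ->
    turn (pts p) k' = ~~ c -> k < k' -> p \in label_paths c X.
  move=> dk dk' tk tk' kk'; apply/label_pathsP; split=> //.
  have [/andP[k0 _] _ _] := dk; have [/andP[_ kp] _ _] := dk'.
  have ss : is_segment lambda (slice (pts p) k k') by apply: trail_segment.
  have [s es] := segment_word ss; exists s; last first.
    by apply/soccP; exists k, k'; rewrite /strict k0 kk' kp tk tk' !eqxx.
  apply/labelsP; rewrite es -tk; apply: (distinguished_label tX pp gp dk dk') => //.
  by rewrite tk tk'.
have [k [dk tk]] := ex true; have [k' [dk' tk']] := ex false.
case: (ltngtP k k') => [kk'|kk'|ekk']; [left|right|].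
- exact: side dk dk' _ _ kk'.
- exact: side dk' dk _ _ kk'.
- by move: tk'; rewrite -ekk' tk.
Qed.

Lemma label_paths_disjoint : label_paths true X :&: label_paths false X = set0.
Proof.
apply/setP => p; rewrite in_set0; apply/negbTE/negP; rewrite in_setI => /andP[].
move=> /label_pathsP[pF [s ls sp]] /label_pathsP[_ [t lt tp]].
have [k [k' [[dk dk' tk tk' kk'] _]]] := label_junctions pF ls sp.
have [l [l' [[dl dl' tl tl' ll'] _]]] := label_junctions pF lt tp.
have e1 : k = l' by apply: (facet_dist_inj pF dk dl'); rewrite tk.
have e2 : k' = l by apply: (facet_dist_inj pF dk' dl); rewrite tk'.
by move: ll'; rewrite -e1 -e2 ltnNge (ltnW kk').
Qed.

Lemma card_facet_labels : #|facet_of X| = #|labels true X| + #|labels false X|.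
Proof.
by rewrite label_pathsU cardsU label_paths_disjoint cards0 subn0 !card_label_paths.
Qed.

End OnePair.

(** Both sizes differ from the number of horizontal edges by the same number of horizontal paths. *)
Lemma card_facet_ofE X Y : torsion_pair X -> torsion_pair Y -> #|facet_of X| = #|facet_of Y|.
Proof.
by move=> /card_facet_of tX /card_facet_of tY; apply: (@addIn #|horizontals lambda|); rewrite tX.
Qed.

(** [Y] is the pair whose half [~~ c] is generated by [X (~~ c)] and [s], so its half [c] is the
    part of [X c] orthogonal to [s]. *)
Lemma flip_facet c X p s : torsion_pair X -> s \in labels c X -> p \in facet_of X ->
  pts s \in soccs c (pts p) -> exists Y q,
  [/\ torsion_pair Y, Y c \proper X c &
      forall Z, torsion_pair Z -> Z c \subset X c -> s \in Z (~~ c) -> Z c \subset Y c] /\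
  [/\ q \in facet_of Y, p != q, facet_of X :\ p = facet_of Y :\ q
    & pts s \in soccs (~~ c) (pts q)].
Proof.
move=> tX ls pF sp.
have xs := labels_sub ls; have sg := subsetP (pair_sub_segs tX c) _ xs.
pose Q := s |: X (~~ c).
have Qs : Q \subset segs lambda by rewrite subUset sub1set sg pair_sub_segs.
pose Y := gen (~~ c) Q; have tY : torsion_pair Y := gen_torsion (~~ c) Qs.
have Yc : Y c = perp (~~ c) Q by have := gen_neq (~~ c) Q; rewrite negbK.
have QY : Q \subset Y (~~ c) := sub_gen (~~ c) Qs.
have sY : s \in Y (~~ c) by apply: subsetP QY _ _; apply: setU11.
have YX : Y c \subset X c.
  apply/subsetP => t; rewrite Yc => /perpP[ts h]; apply: (pair_perp tX) => // f fX.
  by rewrite -homC; apply: h; apply: setU1r.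
have sYc : s \notin Y c by apply/negP => ys; apply: (pair_disjoint tY ys sY).
have /labelsP[/minimalP[_ ms] _] := ls.
(* A common piece of [t] and [s] is in [X c], so minimality of [s] makes it all of [s]. *)
have X_Y t : t \in X c -> ~~ occ c (pts s) (pts t) -> t \in Y c.
  move=> xt nst; rewrite Yc; apply/perpP; split; first exact: subsetP (pair_sub_segs tX c) _ xt.
  move=> f; rewrite homC in_setU1 => /orP[/eqP->|]; last exact: pair_hom.
  apply: contra nst => /homP[u ut us].
  have [u' xu' eu] := pair_closed tX xt ut.
  by rewrite -(ms u) // -eu words_pts.
have FY : facet_of X :\ p \subset facet_of Y.
  apply/subsetP => r /setD1P[rp rX]; have /facet_ofP[rb /goodP gr] := rX.
  apply/facet_ofP; split=> //; apply/goodP => b u ur.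
  have := gr _ _ ur => /wordsP[t xt et]; subst u; rewrite words_pts.
  move: ur xt; have [->|/negb_neq->] := eqVneq b c => ur xt; last first.
    by apply: subsetP QY _ _; apply: setU1r.
  apply: X_Y => //; apply: contra rp => st; apply/eqP.
  by apply: (label_path_unique tX ls rX pF _ sp); apply: socc_trans st ur.
have pY : p \notin facet_of Y.
  apply/negP => /facet_ofP[_ /goodP g]; have := g _ _ sp.
  by rewrite words_pts (negbTE sYc).
(* A minimal word of [Y (~~ c)] that is a proper [c]-slice of [s] would be in [Y c] by [X_Y]. So [s]
   itself is minimal there, and [minimal_path] supplies the new path. *)
have [r rY sr] : exists2 r, r \in facet_of Y & pts s \in soccs (~~ c) (pts r).
  have [u us mu] : exists2 u, occ c u (pts s) & minimal (wds Y) (~~ c) u.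
    have := minimal_exists tY (c := ~~ c) (w := pts s); rewrite words_pts negbK; exact.
  have [u' xu' eu'] := pair_closed tX xs us; rewrite -eu' in us mu.
  have [w [k [k' [pw gw sk ek dk]]]] := minimal_path tY mu.
  have [r er] := path_word pw; subst w.
  have eus : u' = s.
    apply/eqP; apply: contraT => nus.
    have uY : u' \in Y c.
      apply: X_Y => //; apply: contra nus => su.
      by apply/eqP/pts_inj/(occ_anti us su).
    have /minimalP[] := mu; rewrite words_pts => uY' _.
    by case: (pair_disjoint tY uY uY').
  exists r; first by apply/facet_ofP; rewrite (strict_bent pw sk).
  by rewrite -eus; apply/soccP; exists k, k'.
have rX : r \notin facet_of X.
  apply/negP => /facet_ofP[_ /goodP g]; have := g _ _ sr; rewrite words_pts => xs'.
  exact: (pair_disjoint tX xs xs').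
(* The inclusion is known, and the two sets have equal size because all facets do. *)
have eY : facet_of Y = r |: (facet_of X :\ p).
  apply/esym/eqP; rewrite eqEcard subUset sub1set rY FY /=.
  rewrite cardsU1 in_setD1 (negbTE rX) andbF /= (card_facet_ofE tY tX).
  by rewrite (cardsD1 p (facet_of X)) pF.
exists Y, r; split; split=> //.
- by apply/properP; split=> //; exists s.
- move=> Z tZ ZX sZ; apply/subsetP => t zt; rewrite Yc; apply/perpP.
  split; first exact: subsetP (pair_sub_segs tZ c) _ zt.
  move=> f; rewrite homC in_setU1 => /orP[/eqP->|fX]; first exact: (pair_hom tZ).
  by apply: (pair_hom tX) => //; apply: subsetP ZX _ zt.
- by apply: contraNneq pY => ->.
- by rewrite eY setU1K // in_setD1 (negbTE rX) andbF.
Qed.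

(** If the meet [Z] were properly below [X], some label of [X] would be in [Z (~~ c)]. Its path is
    good for [Y], which puts the label in [Y c], hence in [Z c]. *)
Lemma label_paths_sub c X Y : torsion_pair X -> torsion_pair Y ->
  label_paths c X \subset facet_of Y -> X c \subset Y c.
Proof.
move=> tX tY /subsetP h; have [Z tZ eZ] := pair_meet c tX tY.
apply/negPn/negP => nXY.
have [s ls sZ] : exists2 s, s \in labels c X & s \in Z (~~ c).
  apply: label_exists => //; rewrite eZ; first exact: subsetIl.
  by apply: contra nXY; rewrite subsetI => /andP[].
have [p pF sp] := label_path_exists tX ls.
have : p \in facet_of Y by apply: h; apply/label_pathsP; split=> //; exists s.
move=> /facet_ofP[_ /goodP g]; have := g _ _ sp; rewrite words_pts => sY.
apply: (pair_disjoint tZ _ sZ); by rewrite eZ inE sY labels_sub.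
Qed.

(** In this case of [flip_facet] the new path enters [s] from the West and [p] enters it from the
    North, so the flip goes from the smaller pair up to [X]. *)
Lemma flip_down X p s : torsion_pair X -> s \in labels false X -> p \in facet_of X ->
  pts s \in soccs false (pts p) -> exists Y,
  [/\ torsion_pair Y, Y false \proper X false, flip (facet_of Y) (facet_of X) &
      facet_of Y :&: facet_of X = facet_of X :\ p] /\
  forall Z, torsion_pair Z -> Z false \subset X false -> s \in Z true ->
    Z false \subset Y false.
Proof.
move=> tX ls pF sp; have [Y [q [[tY YX mx] [qF npq e sq]]]] := flip_facet tX ls pF sp.
exists Y; split=> //; split=> //.
  apply/existsP; exists s.
  have /facet_ofP[/bentP[pp _] _] := pF; have /facet_ofP[/bentP[pq _] _] := qF.
  apply/and4P; split.
  - exact: (pair_segment tX (labels_sub ls)).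
  - by apply/facetsP; exists Y.
  - by apply/facetsP; exists X.
  apply/exists_inP; exists q => //; apply/exists_inP; exists p => //.
  rewrite eq_sym npq -e eqxx /=.
  by rewrite kiss_alongE ?is_path_sorted ?(socc_nil sp) //; apply/andP.
have pY : p \notin facet_of Y.
  apply/negP => pY; have : p \in facet_of Y :\ q by rewrite in_setD1 npq.
  by rewrite -e in_setD1 eqxx.
apply/setP => r; rewrite in_setI in_setD1.
have [->|nr] := eqVneq r p; first by rewrite (negbTE pY).
apply: andb_idl => rX; have : r \in facet_of X :\ p by rewrite in_setD1 nr.
by rewrite e => /setD1P[].
Qed.

(** Flip [Y] down at a label lying in [X true]: the maximality in [flip_down] keeps the new pair
    above [X], while its half [false] shrinks. *)
Lemma gt_le_sub X Y : torsion_pair X -> torsion_pair Y -> X false \subset Y false ->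
  grid_tamari_le (facet_of X) (facet_of Y).
Proof.
move=> tX; have [m] := ubnP #|Y false|; elim: m Y => // m IH Y; rewrite ltnS => hm tY XY.
have [YX|nYX] := boolP (Y false \subset X false).
  rewrite (eq_facet_of (torsion_pair_eq tX tY (_ : X false = Y false))); first exact: connect0.
  by apply/eqP; rewrite eqEsubset XY.
have [s ls sX] := label_exists tY tX XY nYX.
have [p pF sp] := label_path_exists tY ls.
have [Z [[tZ ZY fl _] mx]] := flip_down tY ls pF sp.
apply: connect_trans (IH Z _ tZ (mx X tX XY sX)) (connect1 fl).
by apply: leq_trans (proper_card ZY) hm.
Qed.

End Flips.

(** * Polynomials *)

Section Polynomials.
Variable T : finType.
Implicit Types (K : {set {set T}}) (A D F : {set T}).

Lemma sum_fnum K (G : nat -> {poly int}) :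
  (\sum_(d < (crank K).+1) (fnum K d)%:Z *: G d = \sum_(A in K) G #|A|)%R.
Proof.
rewrite (partition_big (fun A => inord #|A| : 'I_(crank K).+1) xpredT) //=.
apply: eq_bigr => d _; rewrite -natz scaler_nat /fnum -sumr_const.
have cA A : A \in K -> (inord #|A| == d) = (#|A| == d).
  move=> AK; rewrite -val_eqE /= inordK // ltnS.
  exact: (leq_bigmax_cond (F := fun A : {set T} => #|A|)).
apply: eq_big => A; rewrite inE; last by case/andP=> _ /eqP->.
by case AK: (A \in K) => //=; rewrite cA.
Qed.

Lemma sum_interval (R : comNzRingType) (x : R) D F : D \subset F ->
  (\sum_(A : {set T} | (D \subset A) && (A \subset F)) (x - 1) ^+ (#|F| - #|A|) =
   x ^+ (#|F| - #|D|))%R.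
Proof.
move=> DF.
(* The sum is an expanded product over all points: [a i] is the factor for [i] in [A], [b i] the
   factor for [i] outside. The zeros remove exactly the sets outside the interval. *)
pose a i : R := (i \in F)%:R%R.
pose b i : R := (if i \in D then 0 else if i \in F then x - 1 else 1)%R.
have -> : (x ^+ (#|F| - #|D|) = \prod_i (a i + b i))%R.
  rewrite -cardsDS // -prodr_const [LHS]big_mkcond; apply: eq_bigr => i _.
  rewrite inE /a /b; case iD: (i \in D) => /=.
    by rewrite (subsetP DF _ iD) addr0.
  by case: (i \in F); rewrite ?add0r // addrC subrK.
rewrite bigA_distr big_mkcond; apply: eq_bigr => J _.
have [/andP[DJ JF]|h] := ifPn.
  rewrite -cardsDS // -prodr_const [LHS]big_mkcond; apply: eq_bigr => i _.
  rewrite inE /a /b; case iJ: (i \in J) => /=; first by rewrite (subsetP JF _ iJ).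
  have -> : (i \in D) = false by apply: contraFF iJ => /(subsetP DJ).
  by case: (i \in F).
have [i hi] : exists i, (if i \in J then a i else b i) = 0%R.
  move: h; rewrite negb_and => /orP[]/subsetPn[i i1 i2]; exists i.
    by rewrite (negbTE i2) /b i1.
  by rewrite i1 /a (negbTE i2).
by rewrite (bigD1 i) //= hi mul0r.
Qed.

End Polynomials.

(** * Shelling and the h-polynomial *)

Section Main.
Variable lambda : grid_shape.
Implicit Types (p q s t f : word lambda) (Q A B F : {set word lambda}).
Implicit Types X Y Z : bool -> {set word lambda}.
Local Notation NK := (reduced_nonkissing_complex lambda).
Local Notation NF := (nonfriendly_complex lambda).
Local Notation wds X := (fun c => words (X c)).

Lemma NK_sub A B : A \subset B -> B \in NK -> A \in NK.
Proof.
move=> AB /NK_P[Bb h]; apply/NK_P; split; first exact: subset_trans Bb.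
by move=> c u p q /(subsetP AB) pB /(subsetP AB) qB; apply: h.
Qed.

Lemma crank_NK X : torsion_pair X -> crank NK = #|facet_of X|.
Proof.
move=> tX; apply/eqP; rewrite eqn_leq; apply/andP; split.
  apply/bigmax_leqP => A AK; have [Y tY AY] := NK_sub_facet AK.
  by rewrite (card_facet_ofE tX tY) subset_leq_card.
apply: (leq_bigmax_cond (F := fun A : {set word lambda} => #|A|)).
exact: facet_of_NK.
Qed.

Lemma pure_NK : pure NK.
Proof.
apply/forall_inP => F /facetsP[X tX ->].
by rewrite (crank_NK tX).
Qed.

Theorem linear_extension_shelling (s : seq {set word lambda}) :
  linear_extension (facets NK) (@grid_tamari_le lambda) s -> shelling_order NK s.
Proof.
move=> [[us es] mono]; split=> // [|i j /andP[ij js]]; first exact: pure_NK.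
have is_ := ltn_trans ij js.
have Fi : nth set0 s i \in facets NK by rewrite -es mem_nth.
have Fj : nth set0 s j \in facets NK by rewrite -es mem_nth.
have index_i : index (nth set0 s i) s = i by rewrite index_uniq.
have index_j : index (nth set0 s j) s = j by rewrite index_uniq.
have /facetsP[X tX eX] := Fi; have /facetsP[Y tY eY] := Fj.
(* Otherwise facet [j] would be below facet [i] in the order, against [i < j]. Flipping down a path
   [p] of facet [j] missing from facet [i] gives an earlier facet that loses only [p]. *)
have : ~~ (label_paths false Y \subset facet_of X).
  apply/negP => /(label_paths_sub tY tX) /(gt_le_sub tY tX).
  by rewrite -eX -eY => /(mono _ _ Fj Fi); rewrite index_i index_j leqNgt ij.
move=> /subsetPn[p /label_pathsP[pY [t lt tp]] pX].
have [Z [[tZ ZY fl eI] _]] := flip_down tY lt pY tp.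
have Fk : facet_of Z \in facets NK by apply/facetsP; exists Z.
have ek : nth set0 s (index (facet_of Z) s) = facet_of Z by rewrite nth_index ?es.
exists (index (facet_of Z) s); rewrite ek eY eI -eY; split.
- rewrite ltn_neqAle; apply/andP; split; last first.
    by rewrite -[X in _ <= X]index_j; apply: mono => //; rewrite eY; apply: connect1.
  apply/eqP => ekj; move: eI; rewrite -ek ekj eY setIid => /setP/(_ p).
  by rewrite in_setD1 eqxx pY.
- rewrite /ridge eY (NK_sub (subD1set _ p)) ?facet_of_NK //=.
  by rewrite (crank_NK tY) (cardsD1 p (facet_of Y)) pY.
- apply/subsetP => r; rewrite in_setI => /andP[ri rj]; rewrite in_setD1 rj andbT.
  by apply: contraNneq pX => <-; rewrite -eX.
Qed.

(** * Labels and semibricks *)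

Lemma label_hom c X s t : torsion_pair X -> s \in labels c X -> t \in labels c X ->
  has_hom c (pts s) (pts t) -> s = t.
Proof.
move=> tX ls lt /homP[u us ut].
have [u' xu' eu] := pair_closed tX (labels_sub ls) us.
have /labelsP[/minimalP[_ mt] xt] := lt; have /labelsP[ms _] := ls.
(* Minimality of [t] makes the common word all of [t], so [t] is a [c]-slice of the minimal word
   [s], and a label is not a proper one. *)
have ut' : u = pts t by apply: mt => //; rewrite -eu words_pts.
by apply/pts_inj/xt => //; rewrite -ut'.
Qed.

(** Otherwise [label_exists] gives a label in the opposite half of the pair that the labels
    generate. *)
Lemma gen_labels c X : torsion_pair X -> gen c (labels c X) c = X c.
Proof.
move=> tX.
have lX : labels c X \subset X c by apply/subsetP => s; apply: labels_sub.
have ls : labels c X \subset segs lambda := subset_trans lX (pair_sub_segs tX c).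
have tG := gen_torsion c ls.
apply/eqP; rewrite eqEsubset gen_min //=; apply: contraT => nXG.
have [s sl sG] := label_exists tX tG (gen_min tX lX) nXG.
by case: (pair_disjoint tG (subsetP (sub_gen c ls) _ sl) sG).
Qed.

Lemma labels_gen c A : A \subset segs lambda ->
  {in A &, forall s t, s != t -> ~~ has_hom c (pts s) (pts t)} ->
  labels c (gen c A) = A.
Proof.
move=> As brick; have tG := gen_torsion c As; have AG := sub_gen c As.
set G := gen c A in tG AG *.
(* An element of [G c] is not in the opposite half, hence not orthogonal to [A]. *)
have meets t : t \in G c -> exists s u, [/\ s \in A, occ c u (pts s), occ (~~ c) u (pts t) & words (G c) u].
  move=> tGc; have ts := subsetP (pair_sub_segs tG c) _ tGc.
  have : t \notin perp c A.
    by rewrite -gen_neq; apply/negP => tG'; apply: pair_disjoint tG _ _ tGc tG'.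
  rewrite inE ts /= => /forall_inPn[s sA]; rewrite negbK => /homP[u us ut].
  exists s, u; split=> //; have [u' Gu' <-] := pair_closed tG (subsetP AG _ sA) us.
  by rewrite words_pts.
(* A [~~ c]-slice of [s] in [G c] meets some [s'] of [A], which is [s] by the semibrick condition.
   The common word is then both a quotient and a subword of [s], so it is all of [s]. *)
have minA s : s \in A -> minimal (wds G) c (pts s).
  move=> sA; apply/minimalP; rewrite words_pts (subsetP AG) //; split=> // v vs /wordsP[v' Gv' ev].
  subst v; have [s' [u [s'A us' uv _]]] := meets _ Gv'.
  have us := occ_trans uv vs.
  have e : s' = s.
    apply/eqP; apply: contraT => /(brick _ _ s'A sA)/homP[].
    by exists u.
  subst s'; have su : uniq (pts s).
    by apply: (@segment_uniq lambda); have := subsetP As _ sA; rewrite inE.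
  have eu := occ_both su us' us; rewrite eu in uv.
  by rewrite (occ_anti uv vs).
have uniqA s t u : s \in A -> t \in G c -> minimal (wds G) c (pts t) ->
    occ c u (pts s) -> occ (~~ c) u (pts t) -> words (G c) u -> occ c (pts t) (pts s).
  by move=> sA tGc /minimalP[_ mt] us ut Gu; rewrite -(mt u).
apply/setP => s; apply/idP/idP => [ls|sA].
  have Gs := labels_sub ls; have /labelsP[ms xs] := ls.
  have [s' [u [s'A us' us Gu]]] := meets s Gs.
  have ss' := uniqA _ _ _ s'A Gs ms us' us Gu.
  by have -> : s = s' by apply/esym/pts_inj/xs => //; apply: minA.
apply/labelsP; split=> [|t mt st]; first exact: minA.
have /minimalP[/wordsP[t' Gt' et] _] := mt; subst t.
have [s' [u [s'A us' ut Gu]]] := meets _ Gt'.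
have ts' := uniqA _ _ _ s'A Gt' mt us' ut Gu.
have e : s = s'.
  apply/esym/eqP; apply: contraT => /(brick _ _ s'A sA)/homP[].
  exists (pts s); first exact: occ_trans st ts'.
  by apply/occ_refl/(occ_nil st).
by subst s'; apply: occ_anti ts' st.
Qed.

Lemma friendlyE s t : s \in segs lambda -> t \in segs lambda ->
  friendly s t = has_hom true (pts s) (pts t) || has_hom true (pts t) (pts s).
Proof.
rewrite !inE => ss ts; have Ss := trail_sorted (segment_trail ss).
have St := trail_sorted (segment_trail ts).
apply/existsP/orP => [[u /andP[/segment_nil u0]]|].
  by rewrite !friendly_alongE // => /orP[]/andP[o1 o2]; [left|right]; apply/homP; exists (pts u).
have ex a b : is_segment lambda a -> has_hom true a b ->
    exists u : word lambda, [/\ is_segment lambda (pts u), occ true (pts u) a & occ false (pts u) b].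
  move=> sa /homP[u o1 o2]; have su := occ_segment sa o1.
  by have [u' eu] := segment_word su; exists u'; rewrite eu.
case=> [/(ex _ _ ss)|/(ex _ _ ts)] [u [su o1 o2]]; exists u;
  by rewrite su !friendly_alongE ?(segment_nil su) // o1 o2 ?orbT.
Qed.

Lemma NF_P A : reflect (A \subset segs lambda /\
    {in A &, forall s t, s != t -> ~~ has_hom true (pts s) (pts t)}) (A \in NF).
Proof.
rewrite inE -/(segs lambda); apply: (iffP andP) => -[As h]; split=> //.
  move=> s t sA tA nst; move/forall_inP/(_ s sA)/forall_inP/(_ t tA): h.
  by rewrite nst friendlyE ?(subsetP As) // negb_or => /andP[].
apply/forall_inP => s sA; apply/forall_inP => t tA; apply/implyP => nst.
by rewrite friendlyE ?(subsetP As) // negb_or !h // eq_sym.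
Qed.

(** * Counting facets by labels and faces by intervals *)

Definition pair_of F : bool -> {set word lambda} := gen true (strict_slices true F).

Lemma pair_ofP F : F \in facets NK -> torsion_pair (pair_of F) /\ facet_of (pair_of F) = F.
Proof.
rewrite inE => /maxsetP[FK mx].
have Fb : F \subset bent lambda by have /NK_P[] := FK.
have tF : torsion_pair (pair_of F) by apply/gen_torsion/strict_slices_segs.
split=> //; apply: mx; last exact: sub_facet_of.
exact: facet_of_NK.
Qed.

Lemma pair_of_facet_of X : torsion_pair X -> pair_of (facet_of X) =1 X.
Proof.
move=> tX; have [tF eF] := pair_ofP (introT (facetsP _) (ex_intro2 _ _ X tX erefl)).
by apply: facet_of_mono => //; rewrite eF.
Qed.

Lemma eq_labels c X Y : X =1 Y -> labels c X = labels c Y.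
Proof. by move=> e; apply/setP => s; rewrite !inE /minimal !e. Qed.

(** Sending a facet to its labels in the half [true] is a bijection onto the nonfriendly sets:
    [gen_labels] recovers the pair from the labels, and [labels_gen] shows that every nonfriendly
    set arises. *)
Lemma facet_labels_bij : (\sum_(F in facets NK) 'X^(#|labels true (pair_of F)|) =
  \sum_(A in NF) 'X^(#|A|) :> {poly int})%R.
Proof.
have inj : {in facets NK &, injective (fun F => labels true (pair_of F))}.
  move=> F F' /pair_ofP[tF eF] /pair_ofP[tF' eF'] e; rewrite -eF -eF'.
  apply/eq_facet_of/(torsion_pair_eq tF tF' (c := true)).
  by rewrite -(gen_labels true tF) -(gen_labels true tF') e.
rewrite -(big_imset (fun A => 'X^(#|A|)%R) inj); apply: eq_bigl => A.
apply/imsetP/NF_P => [[F /pair_ofP[tF _] ->]|[As brick]].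
  split=> [|s t ls lt]; last by apply: contra => /(label_hom tF ls lt)->.
  by apply/subsetP => s /labels_sub; apply: subsetP (pair_sub_segs tF true) _.
have tG := gen_torsion true As; exists (facet_of (gen true A)).
  by apply/facetsP; exists (gen true A).
by rewrite (eq_labels true (pair_of_facet_of tG)) labels_gen.
Qed.

(** The paths whose flips lead down in the order; they form the bottom of the interval of faces
    assigned to [F]. *)
Definition down F := label_paths false (pair_of F).

Lemma down_facet_of X : torsion_pair X -> down (facet_of X) = label_paths false X.
Proof.
move=> tX; have e := pair_of_facet_of tX.
by rewrite /down /label_paths (eq_facet_of e) (eq_labels false e).
Qed.

(* [F0] is the smallest facet containing [A] in the Grid-Tamari order. *)
Lemma face_interval A : A \in NK -> exists F0,
  (fun F => [&& F \in facets NK, down F \subset A & A \subset F]) =1 pred1 F0.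
Proof.
move=> AK; have Ab : A \subset bent lambda by have /NK_P[] := AK.
pose X := gen false (strict_slices false A).
have tX : torsion_pair X := gen_torsion false (strict_slices_segs false Ab).
have AX : A \subset facet_of X := sub_facet_of false AK.
have mX Y : torsion_pair Y -> A \subset facet_of Y -> X false \subset Y false.
  exact: gen_strict_slices_min.
exists (facet_of X) => F; apply/and3P/eqP => [[/facetsP[Y tY ->]]|->].
  rewrite down_facet_of // => DA AY.
  apply/eq_facet_of/(torsion_pair_eq tY tX (c := false))/eqP.
  by rewrite eqEsubset mX // andbT (label_paths_sub tY tX) // (subset_trans DA).
split=> //; first by apply/facetsP; exists X.
rewrite down_facet_of //; apply/subsetP => p /label_pathsP[pX [s ls sp]].
(* Flipping down a path outside [A] would give a facet that still contains [A], although [X false]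
   is already the smallest possible. *)
apply: contraT => pA; have [Z [[tZ ZX _ eI] _]] := flip_down tX ls pX sp.
have AZ : A \subset facet_of Z.
  apply: subset_trans (subsetIl _ (facet_of X)); rewrite eI.
  by apply/subsetD1P.
by have := proper_sub_trans ZX (mX Z tZ AZ); rewrite properxx.
Qed.

(** Each face is assigned to its unique interval from [down F] to [F] and the sums are exchanged.
    The interval contributes the exponent [#|F| - #|down F|], the number of labels in the half
    [true]. *)
Lemma h_polyE : (h_poly NK = \sum_(F in facets NK) 'X^(#|labels true (pair_of F)|))%R.
Proof.
rewrite /h_poly (sum_fnum NK (fun d => ('X - 1) ^+ (crank NK - d))%R).
transitivity (\sum_(A in NK) \sum_(F | [&& F \in facets NK, down F \subset A & A \subset F])
    ('X - 1) ^+ (crank NK - #|A|) : {poly int})%R.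
  by apply: eq_bigr => A /face_interval[F0 e]; rewrite (big_pred1 F0).
rewrite (exchange_big_dep (mem (facets NK))) /=; last by move=> A F _ /and3P[].
apply: eq_bigr => F FK; have [tF eF] := pair_ofP FK.
have DF : down F \subset F.
  by apply/subsetP => p /label_pathsP[]; rewrite eF.
have cF : crank NK = #|F| by rewrite (crank_NK tF) eF.
transitivity (\sum_(A : {set word lambda} | (down F \subset A) && (A \subset F))
    ('X - 1) ^+ (#|F| - #|A|) : {poly int})%R.
  rewrite cF; apply: eq_bigl => A; rewrite FK /=.
  case AF: (A \subset F); rewrite ?andbF ?andbT //.
  by rewrite (NK_sub AF) // -eF facet_of_NK.
rewrite sum_interval // (card_label_paths tF) -eF (card_facet_labels tF) eF.
by rewrite addnK.
Qed.

End Main.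

Theorem lemma6p1 (lambda : grid_shape) :
  (forall s : seq {set word lambda},
     linear_extension (facets (reduced_nonkissing_complex lambda))
       (@grid_tamari_le lambda) s ->
     shelling_order (reduced_nonkissing_complex lambda) s) /\
  h_poly (reduced_nonkissing_complex lambda) =
  f_poly (nonfriendly_complex lambda).
Proof.
split; first exact: linear_extension_shelling.
by rewrite h_polyE facet_labels_bij /f_poly (sum_fnum _ (fun d => 'X^d)%R).
Qed.
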